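(* Suppose that $\gamma_i^+=-\gamma_i^-$ for all $i=1,2,\dots,d$. Then the integration by parts formulas $$(\mathrm{div}_h^\pm\boldsymbol{v}_h,\varphi_h)_{\mathcal{T}_h}=-(\boldsymbol{v}_h,\nabla_h^\mp\varphi_h)_{\mathcal{T}_h}+\langle\boldsymbol{v}_h\cdot n,\varphi_h\rangle_{\mathcal{E}_h^B}$$ and $$(\mathrm{div}_h\boldsymbol{v}_h,\varphi_h)_{\mathcal{T}_h}=-(\boldsymbol{v}_h,\nabla_h\varphi_h)_{\mathcal{T}_h}+\langle\boldsymbol{v}_h\cdot n,\varphi_h\rangle_{\mathcal{E}_h^B}$$ hold for all $\boldsymbol{v}_h\in\boldsymbol{V}_r^h$ and $\varphi_h\in V_r^h$.
   Context: Mesh and spaces. $\Omega\subset\mathbf{R}^d$ is a bounded open domain and $\mathcal{T}_h$ is a locally quasi-uniform, shape-regular partition of $\Omega$ into (finitely many, polytopal) elements with flat faces. $\mathcal{E}_h^I$, $\mathcal{E}_h^B$ denote the sets of interior and boundary faces/edges, $\mathcal{E}_h=\mathcal{E}_h^I\cup\mathcal{E}_h^B$. $W^{m,p}(\mathcal{T}_h)=\prod_{K}W^{m,p}(K)$, $C^m(\mathcal{T}_h)=\prod_K C^m(\overline K)$. For a fixed integer $r\ge 0$, $V_r^h=\prod_{K\in\mathcal{T}_h}\mathbb{P}_r(K)$, where $\mathbb{P}_r(K)$ is the set of polynomials on $K$ of degree at most $r$, and $\boldsymbol{V}_r^h=[V_r^h]^d$. $\mathcal{V}_h=W^{1,1}(\mathcal{T}_h)\cap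 C^0(\mathcal{T}_h)$ (so $V_r^h\subset\mathcal{V}_h$). $(v,w)_{\mathcal{T}_h}=\sum_K\int_K vw\,dx$ (with the dot product for vector-valued functions), and $\langle v,w\rangle_{\mathcal{S}}=\sum_{e\in\mathcal{S}}\int_e vw\,ds$ for $\mathcal{S}\subset\mathcal{E}_h$; derivatives of piecewise functions inside $(\cdot,\cdot)_{\mathcal{T}_h}$ are taken elementwise. Jumps, averages, normals. Elements are globally numbered. For $e=\partial K\cap\partial K'\in\mathcal{E}_h^I$ with $K$ having the smaller number: $[v]=v|_K-v|_{K'}$, $\{v\}=\frac12(v|_K+v|_{K'})$, $n_e=n_K|_e=-n_{K'}|_e$ ($n_K$ is the outward unit normal of $K$). On $e\in\mathcal{E}_h^B$: $[v]=\{v\}=v$ and $n_e$ is the outward unit normal of $\Omega$. $n$ is the function on faces with $n|_e=n_e$, and $n^{(i)}$ is its $i$th component. Trace operators. On $e=\partial K\cap \partial K'\in\mathcal{E}_h^I$ ($K$ with smaller number): $\mathcal{Q}_i^-(v)$ is the trace of $v|_K$ if $n_e^{(i)}<0$ and of $v|_{K'}$ if $n_e^{(i)}\ge0$; $\mathcal{Q}_i^+(v)$ is the trace of $v|_{K'}$ if $n_e^{(i)}<0$ and of $v|_K$ if $n_e^{(i)}\ge 0$. On $e\in\mathcal{E}_h^B$, $\mathcal{Q}_i^\pm(v)$ is the trace of $v$. Discrete derivatives. Let $\gamma_i^\pm$ ($i=1,\dots,d$) be given functions that are piecewise constant with respect to $\mathcal{E}_h^I$. For $v\in\mathcal{V}_h$,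 $\partial_{h,x_i}^\pm v\in V_r^h$ is defined by $$(\partial_{h,x_i}^\pm v,\varphi_h)_{\mathcal{T}_h}=\langle\mathcal{Q}_i^\pm(v)n^{(i)},[\varphi_h]\rangle_{\mathcal{E}_h}-(v,\partial_{x_i}\varphi_h)_{\mathcal{T}_h}+\langle\gamma_i^\pm[v],[\varphi_h]\rangle_{\mathcal{E}_h^I}\quad\forall\varphi_h\in V_r^h.$$ Discrete gradient and divergence: $\nabla_h^\pm v=(\partial_{h,x_1}^\pm v,\dots,\partial_{h,x_d}^\pm v)^t$, $\nabla_hv=\frac12(\nabla_h^-v+\nabla_h^+v)$ for $v\in\mathcal{V}_h$; $\mathrm{div}_h^\pm\boldsymbol{v}=\sum_{i=1}^d\partial_{h,x_i}^\pm v_i$, $\mathrm{div}_h\boldsymbol{v}=\frac12(\mathrm{div}_h^-\boldsymbol{v}+\mathrm{div}_h^+\boldsymbol{v})$ for $\boldsymbol{v}=(v_1,\dots,v_d)^t\in[\mathcal{V}_h]^d$. In formulas with $\pm$ and $\mp$, either all upper or all lower signs are taken. *)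

(* Defs.v *)
From HB Require Import structures.
From mathcomp Require Import all_boot all_order all_algebra.
From mathcomp Require Import all_classical all_reals all_analysis.
(* Its notations clash with those of MathComp-Analysis. *)
From mathcomp Require mpoly.
Import (canonicals, coercions) mpoly.

Set Implicit Arguments.
Unset Strict Implicit.
Unset Printing Implicit Defensive.

Import Order.TTheory GRing.Theory Num.Theory.
Import numFieldNormedType.Exports.

Local Open Scope classical_set_scope.
Local Open Scope ring_scope.

Fact rV_display : measure_display. Proof. exact: default_measure_display. Qed.

Section rV_measurable.
Variables (R : realType) (d : nat).

Definition rV_coord (i : 'I_d) (x : 'rV[R]_d) : measurableTypeR R := x ord0 i.

Let rV_set0 : g_sigma_preimage rV_coord set0.
Proof. exact: sigma_algebra0. Qed.

Let rV_setC A : g_sigma_preimage rV_coord A -> g_sigma_preimage rV_coord (~` A).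
Proof. exact: sigma_algebraC. Qed.

Let rV_bigcup (F : (set 'rV[R]_d)^nat) :
  (forall i, g_sigma_preimage rV_coord (F i)) ->
  g_sigma_preimage rV_coord (\bigcup_i (F i)).
Proof. exact: sigma_algebra_bigcup. Qed.

HB.instance Definition _ := @isMeasurable.Build rV_display
  'rV[R]_d (g_sigma_preimage rV_coord) rV_set0 rV_setC rV_bigcup.

End rV_measurable.

Lemma measurable_rV_coord (R : realType) (d : nat) (i : 'I_d) :
  measurable_fun setT (@rV_coord R d i).
Proof.
move=> _ Y mY; rewrite setTI; apply: sub_sigma_algebra => /=.
rewrite -bigcup_seq/=; exists i => /=; first by rewrite mem_index_enum.
by exists Y => //; rewrite setTI.
Qed.

Lemma measurable_fun_rVP (R : realType) (dT : measure_display)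
    (T : measurableType dT) (d : nat) (f : T -> 'rV[R]_d) :
  (forall i, measurable_fun setT (rV_coord i \o f)) -> measurable_fun setT f.
Proof.
move=> mf.
suff h : g_sigma_preimage (fun i => rV_coord i \o f) `<=` measurable.
  move=> _ A mA; apply: h.
  by rewrite g_sigma_preimage_comp; exists A.
apply: smallest_sub; first exact: sigma_algebra_measurable.
case: d => [|n] in f mf *; first by rewrite big_ord0.
rewrite -bigcup_mkord_ord; apply: bigcup_sub => i Ii.
by move=> A [B mB <-]; exact: mf.
Qed.

Section lebesgue_rV.
Variable R : realType.

Definition cons_rV (d : nat) (p : measurableTypeR R * 'rV[R]_d) : 'rV[R]_d.+1 :=
  \row_i oapp (fun j => p.2 ord0 j) p.1 (unlift ord0 i).

Definition uncons_rV (d : nat) (x : 'rV[R]_d.+1) : measurableTypeR R * 'rV[R]_d :=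
  (x ord0 ord0, \row_j x ord0 (lift ord0 j)).

Lemma cons_rVK (d : nat) : cancel (@cons_rV d) (@uncons_rV d).
Proof.
move=> [a v]; rewrite /uncons_rV !mxE unlift_none /=; congr (_, _).
by apply/rowP => j; rewrite !mxE liftK.
Qed.

Lemma measurable_cons_rV (d : nat) : measurable_fun setT (@cons_rV d).
Proof.
apply: measurable_fun_rVP => i; case: (unliftP ord0 i) => [j ->|->].
- rewrite (_ : _ \o _ = rV_coord j \o snd).
    by apply: measurableT_comp => //; exact: measurable_rV_coord.
  by apply/funext => -[a v] /=; rewrite /rV_coord mxE liftK.
- rewrite (_ : _ \o _ = fst) //.
  by apply/funext => -[a v] /=; rewrite /rV_coord mxE unlift_none.
Qed.

Lemma measurable_uncons_rV (d : nat) : measurable_fun setT (@uncons_rV d).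
Proof.
apply: measurable_fun_pair; first exact: (measurable_rV_coord ord0).
apply: measurable_fun_rVP => i.
rewrite (_ : _ \o _ = rV_coord (lift ord0 i)); first exact: measurable_rV_coord.
by apply/funext => x /=; rewrite /rV_coord mxE.
Qed.

Section step.
Variables (d : nat) (mu : {sigma_finite_measure set 'rV[R]_d -> \bar R}).

Definition lebesgue_rV_step : set 'rV[R]_d.+1 -> \bar R :=
  pushforward (@lebesgue_measure R \x mu)%E (@cons_rV d).

Let step0 : lebesgue_rV_step set0 = 0%E.
Proof. by rewrite /lebesgue_rV_step /pushforward preimage_set0 measure0. Qed.

Let step_ge0 A : (0 <= lebesgue_rV_step A)%E.
Proof. by rewrite /lebesgue_rV_step /pushforward measure_ge0. Qed.

Let step_sigma_additive : semi_sigma_additive lebesgue_rV_step.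
Proof.
have mf : measurable_fun setT (@cons_rV d) := @measurable_cons_rV d.
move=> F mF tF mUF; rewrite /lebesgue_rV_step /pushforward preimage_bigcup.
apply: measure_semi_sigma_additive.
- by move=> n; rewrite -[X in measurable X]setTI; exact: mf.
- apply/trivIsetP => /= i j _ _ ij; rewrite -preimage_setI.
  by move/trivIsetP : tF => /(_ _ _ _ _ ij) ->//; rewrite preimage_set0.
- by rewrite -preimage_bigcup -[X in measurable X]setTI; exact: mf.
Qed.

HB.instance Definition _ := isMeasure.Build _ _ _ lebesgue_rV_step
  step0 step_ge0 step_sigma_additive.

Let step_sigma_finite : sigma_finite setT lebesgue_rV_step.
Proof.
have /sigma_finiteP[F [FT ndF mF]] := sigma_finiteT (@lebesgue_measure R).
have /sigma_finiteP[G [GT ndG mG]] := sigma_finiteT mu.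
exists (fun n => @uncons_rV d @^-1` (F n `*` G n)).
  apply/esym; rewrite -subTset => x _.
  have [n _ Fn] : (\bigcup_n F n) (uncons_rV x).1 by rewrite -FT.
  have [m _ Gm] : (\bigcup_n G n) (uncons_rV x).2 by rewrite -GT.
  exists (maxn n m) => //; split => /=.
  - by move: Fn; exact/subsetPset/ndF/leq_maxl.
  - by move: Gm; exact/subsetPset/ndG/leq_maxr.
move=> n; have [mFn Fnoo] := mF n; have [mGn Gnoo] := mG n; split.
  rewrite -[X in measurable X]setTI; apply: measurable_uncons_rV => //.
  exact: measurableX.
rewrite /lebesgue_rV_step /pushforward -comp_preimage.
rewrite (_ : _ \o _ = idfun); last first.
  by apply/funext => p /=; rewrite cons_rVK.
by rewrite preimage_id product_measure1E // lte_mul_pinfty // ge0_fin_numE.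
Qed.

HB.instance Definition _ := Measure_isSigmaFinite.Build _ _ _ lebesgue_rV_step
  step_sigma_finite.

End step.

(* R^0 is a point of measure 1, and R^(d+1) = R * R^d. *)
Fixpoint lebesgue_rV (d : nat) : {sigma_finite_measure set 'rV[R]_d -> \bar R} :=
  match d with
  | 0 => @dirac _ 'rV[R]_0 0 R
  | n.+1 => lebesgue_rV_step (lebesgue_rV n)
  end.

End lebesgue_rV.
Arguments lebesgue_rV : clear implicits.

Section geometry.
Variables (R : realType) (d : nat).
Implicit Types (x y n : 'rV[R]_d) (A : set 'rV[R]_d).

Definition dot x y : R := \sum_(i < d) x ord0 i * y ord0 i.

(* The norm [`|x|] of the library is the sup norm. *)
Definition enorm x : R := Num.sqrt (dot x x).

Definition diameter A : R := sup [set enorm (x - y) | x in A & y in A].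

Definition convex_polytope A : Prop :=
  bounded_set A /\
  exists (m : nat) (a : 'I_m -> 'rV[R]_d) (b : 'I_m -> R),
    A = [set x | forall k, dot (a k) x <= b k].

(* Not necessarily convex, and possibly of dimension less than [d]. *)
Definition polytope A : Prop :=
  exists (m : nat) (P : 'I_m -> set 'rV[R]_d),
    (forall k, convex_polytope (P k)) /\ A = \bigcup_k P k.

Definition boundary A : set 'rV[R]_d := closure A `\` A°.

(* [A] lies locally on one flat side of its boundary at [x], which defines
   the outward unit normal there. *)
Definition outward_unit_normal A x n : Prop :=
  dot n n = 1 /\ \forall y \near x, A y <-> dot n (y - x) < 0.

Record flat_face := FlatFace {
  face_set : set 'rV[R]_d;
  face_normal : 'rV[R]_d;
  face_offset : R }.

Definition height (e : flat_face) x : R :=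
  dot (face_normal e) x - face_offset e.

Definition relint (e : flat_face) : set 'rV[R]_d :=
  [set x | face_set e x /\
    \forall y \near x, height e y = 0 -> face_set e y].

(* A polytope of pure dimension [d - 1] inside a hyperplane. *)
Definition is_flat_face (e : flat_face) : Prop :=
  [/\ dot (face_normal e) (face_normal e) = 1,
      (forall x, face_set e x -> height e x = 0),
      polytope (face_set e), face_set e !=set0 &
      face_set e `<=` closure (relint e)].

(* Integral for the [(d - 1)]-dimensional surface measure: in orthonormal
   coordinates (position in the hyperplane, height above it) the Lebesgue
   measure is the product of the surface measure and of the length, so we
   integrate over the right prism of height 1 and base [e] the function that
   is constant along the normal and equal to [f] on [e]. *)
Definition face_integral (e : flat_face) (f : 'rV[R]_d -> R) : R :=
  let foot x := x - height e x *: face_normal e in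
  \int[lebesgue_rV R d]_(x in [set x | 0 <= height e x <= 1 /\ face_set e (foot x)])
    f (foot x).

End geometry.

(* The faces are listed explicitly: for a nonconvex element, or with hanging
   nodes, the common boundary of two elements may consist of several flat
   pieces, each of which is a face. *)
Record mesh (R : realType) (d : nat) (Omega : set 'rV[R]_d) := Mesh {
  nelt : nat;
  elt : 'I_nelt -> set 'rV[R]_d;
  iface : finType;
  bface : finType;
  igeom : iface -> flat_face R d;
  bgeom : bface -> flat_face R d;
  (* the two elements sharing an interior face, the smaller number first *)
  fst_elt : iface -> 'I_nelt;
  snd_elt : iface -> 'I_nelt;
  own_elt : bface -> 'I_nelt;

  elt_neq0 : forall K, elt K !=set0;
  elt_sub : forall K, elt K `<=` Omega;
  (* elements are open and do not lie on both sides of their boundary *)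
  elt_regular : forall K, (closure (elt K))° = elt K;
  elt_polytope : forall K, polytope (closure (elt K));
  elt_disjoint : forall K L, K != L -> elt K `&` elt L = set0;
  elt_cover : closure Omega = \bigcup_K closure (elt K);

  iface_flat : forall e, is_flat_face (igeom e);
  bface_flat : forall e, is_flat_face (bgeom e);
  fst_snd_lt : forall e, (fst_elt e < snd_elt e)%N;
  iface_sub : forall e,
    face_set (igeom e) `<=` boundary (elt (fst_elt e)) `&` boundary (elt (snd_elt e));
  bface_sub : forall e,
    face_set (bgeom e) `<=` boundary (elt (own_elt e)) `&` boundary Omega;
  iface_normal : forall e x, relint (igeom e) x ->
    outward_unit_normal (elt (fst_elt e)) x (face_normal (igeom e)) /\
    outward_unit_normal (elt (snd_elt e)) x (- face_normal (igeom e));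
  bface_normal : forall e x, relint (bgeom e) x ->
    outward_unit_normal (elt (own_elt e)) x (face_normal (bgeom e)) /\
    outward_unit_normal Omega x (face_normal (bgeom e));
  iface_disjoint : forall e e', e != e' ->
    relint (igeom e) `&` relint (igeom e') = set0;
  bface_disjoint : forall e e', e != e' ->
    relint (bgeom e) `&` relint (bgeom e') = set0;
  elt_boundary : forall K, boundary (elt K) =
    \bigcup_(e in [set e | fst_elt e = K \/ snd_elt e = K]) face_set (igeom e) `|`
    \bigcup_(e in [set e | own_elt e = K]) face_set (bgeom e);
  domain_boundary : boundary Omega = \bigcup_e face_set (bgeom e) }.

Section discrete_calculus.
Variables (R : realType) (d : nat) (Omega : set 'rV[R]_d) (T : mesh Omega).

Definition shape_regular (sigma : R) : Prop :=
  forall K : 'I_(nelt T), exists x,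
    [set y | enorm (y - x) < sigma * diameter (elt K)] `<=` elt K.

Definition locally_quasi_uniform (tau : R) : Prop :=
  forall e : iface T,
    diameter (elt (fst_elt e)) <= tau * diameter (elt (snd_elt e)) /\
    diameter (elt (snd_elt e)) <= tau * diameter (elt (fst_elt e)).

(* A piecewise function; only the values of [v K] on the closure of the
   element [K] are relevant. *)
Definition pwfun := 'I_(nelt T) -> 'rV[R]_d -> R.

Definition polynomial_fun (r : nat) (f : 'rV[R]_d -> R) : Prop :=
  exists p : mpoly.mpoly d R,
    (mpoly.msize p <= r.+1)%N /\ f = (fun x => mpoly.meval (x ord0) p).

Definition Vh (r : nat) (v : pwfun) : Prop :=
  forall K, polynomial_fun r (v K).

Definition inner_elts (v w : pwfun) : R :=
  \sum_K \int[lebesgue_rV R d]_(x in elt K) (v K x * w K x).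

Definition inner_elts_vec (v w : 'I_d -> pwfun) : R :=
  \sum_K \int[lebesgue_rV R d]_(x in elt K) (\sum_(i < d) v i K x * w i K x).

Definition pderiv (i : 'I_d) (v : pwfun) : pwfun :=
  fun K x => 'D_(delta_mx ord0 i) (v K) x.

Definition face := (iface T + bface T)%type.

Definition geom (e : face) : flat_face R d :=
  match e with inl e => igeom e | inr e => bgeom e end.

Definition normal_comp (i : 'I_d) (e : face) : R :=
  face_normal (geom e) ord0 i.

Definition facefun := face -> 'rV[R]_d -> R.

Definition inner_ifaces (g h : facefun) : R :=
  \sum_(e : iface T) face_integral (igeom e) (fun x => g (inl e) x * h (inl e) x).

Definition inner_bfaces (g h : facefun) : R :=
  \sum_(e : bface T) face_integral (bgeom e) (fun x => g (inr e) x * h (inr e) x).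

Definition inner_faces (g h : facefun) : R :=
  inner_ifaces g h + inner_bfaces g h.

Definition jump (v : pwfun) : facefun := fun e x =>
  match e with
  | inl e => v (fst_elt e) x - v (snd_elt e) x
  | inr e => v (own_elt e) x
  end.

(* Only used on boundary faces. *)
Definition btrace (v : pwfun) : facefun := fun e x =>
  match e with inl _ => 0 | inr e => v (own_elt e) x end.

(* In all that follows a sign is a boolean, [true] for [+]. *)
Definition Qtrace (s : bool) (i : 'I_d) (v : pwfun) : facefun := fun e x =>
  match e with
  | inl e' =>
      if s then
        if normal_comp i e < 0 then v (snd_elt e') x else v (fst_elt e') x
      else
        if normal_comp i e < 0 then v (fst_elt e') x else v (snd_elt e') x
  | inr e' => v (own_elt e') x
  end.

Variables (gamma : bool -> 'I_d -> iface T -> R) (r : nat).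

Definition penalty (s : bool) (i : 'I_d) (v : pwfun) : facefun := fun e x =>
  match e with inl e' => gamma s i e' * jump v e x | inr _ => 0 end.

Definition is_discrete_deriv (s : bool) (i : 'I_d) (v w : pwfun) : Prop :=
  Vh r w /\
  forall phi, Vh r phi ->
    inner_elts w phi =
      inner_faces (fun e x => Qtrace s i v e x * normal_comp i e) (jump phi)
      - inner_elts v (pderiv i phi)
      + inner_ifaces (penalty s i v) (jump phi).

(* [w] is unique, because a polynomial is determined by its values on a
   nonempty open set. The operator is total, but it is only meaningful for
   functions that are W^{1,1} on each element and continuous up to its
   boundary, such as the members of [Vh r]. *)
Definition discrete_deriv (s : bool) (i : 'I_d) (v : pwfun) : pwfun :=
  get [set w | is_discrete_deriv s i v w].

Definition grad_sign (s : bool) (v : pwfun) : 'I_d -> pwfun :=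
  fun i => discrete_deriv s i v.

Definition grad (v : pwfun) : 'I_d -> pwfun :=
  fun i K x => 2^-1 * (grad_sign false v i K x + grad_sign true v i K x).

Definition div_sign (s : bool) (v : 'I_d -> pwfun) : pwfun :=
  fun K x => \sum_(i < d) discrete_deriv s i (v i) K x.

Definition div (v : 'I_d -> pwfun) : pwfun :=
  fun K x => 2^-1 * (div_sign false v K x + div_sign true v K x).

Definition normal_trace (v : 'I_d -> pwfun) : facefun :=
  fun e x => \sum_(i < d) btrace (v i) e x * normal_comp i e.

End discrete_calculus.

(* Main.v *)
Require Import Defs.
From mathcomp Require Import all_boot all_order all_algebra.
From mathcomp Require Import all_classical all_reals all_analysis.
From mathcomp Require Import measurable_realfun.
From mathcomp Require Import ring lra.
From mathcomp Require mpoly.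
Import (canonicals, coercions) mpoly.

Set Implicit Arguments.
Unset Strict Implicit.
Unset Printing Implicit Defensive.

Import Order.TTheory GRing.Theory Num.Theory.
Import numFieldNormedType.Exports.

Local Open Scope classical_set_scope.
Local Open Scope ring_scope.

(** The two discrete derivatives are adjoint to each other up to boundary terms,
    because each of them is defined by its action on test functions. Take one
    component, and add the identity that defines the derivative of v of sign s,
    tested with phi, to the identity that defines the derivative of phi of the
    opposite sign, tested with v. The volume terms add up to the integral of
    the derivative of the product v phi over all elements. The divergence
    theorem turns it into integrals over the faces, where it cancels all but
    the boundary term: on an interior face [v phi] = Q^s(v) [phi] + Q^-s(phi) [v],
    the two trace operators picking opposite sides, and the penalties cancel by
    the relation between the two families gamma
    ([discrete_deriv_by_parts]). The vector formulas are sums of this identity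
    over the components and means over the two signs.

    Two facts have to be established first. One is that the discrete derivatives
    exist. A linear form on the finite-dimensional space of piecewise
    polynomials is represented by one of its members for the L2 product, which
    is definite because a polynomial whose square has integral zero over a
    nonempty open set is zero ([riesz], [polynomial_sqr_eq0]).

    The other one is the divergence theorem for a polynomial f on a polytope K
    that is not necessarily convex, with face integrals taken over prisms
    ([divergence]). Let u be a direction. By translation
    invariance the integrand, the indicator of K times the derivative of f along
    u, may be replaced by its mean over the segment from x to x + u
    ([integral_average]). On almost every line parallel to u the boundary of K
    is met in finitely many points, each of them a relative interior point of
    one face that is crossed transversally; there the indicator of K plus the sum
    over the faces crossed by the line of the indicators of their outer sides is
    constant ([crossing_cst]). The fundamental theorem of calculus then evaluates
    the mean over the segment: two endpoint terms, which cancel after integration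
    over x, and one term for each face that the segment crosses
    ([segment_identity]). Integrated over x, each of the latter becomes up to sign
    the integral over an oblique prism of the function equal to f on the face and
    constant along u, and a linear change of variables makes this prism upright
    ([face_integral_oblique]).

    That change of variables is a rank-one perturbation of the identity. On
    each line in the direction of the perturbation it is an affine map, so
    Tonelli's theorem reduces it to a substitution on the real line
    ([ge0_integral_slide]). *)

(** * Lebesgue measure and translations *)

Section line.
Variable R : realType.
Local Notation leb := (@lebesgue_measure R).

Lemma measurable_affine (a b : R) :
  measurable_fun setT (fun s : measurableTypeR R => a + b * s : measurableTypeR R).
Proof.
apply: measurable_funD; first exact: measurable_cst.
by apply: measurable_funM; [exact: measurable_cst|exact: measurable_id].
Qed.

(** A measure on the line is determined by its values on half-open intervals. If the slope
    is negative, their preimages are closed at the other end, which does not change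
    their length. *)
Lemma lebesgue_affine (a b : R) (A : set (measurableTypeR R)) : b != 0 ->
  measurable A ->
  leb A = (`|b|%:E * leb [set s | A (a + b * s)%R])%E.
Proof.
move=> b0 mA.
pose f : measurableTypeR R -> measurableTypeR R := fun s => a + b * s.
have mf : measurable_fun setT f by exact: measurable_affine.
pose nb : {nonneg R} := NngNum (normr_ge0 b).
rewrite (@lebesgue_measure_unique R (mscale nb (pushforward leb f : {measure set _ -> \bar R})))//.
move=> _ [[x y]/= _ <-].
rewrite /mscale/= /pushforward.
have [b_gt0|b_lt0] : 0 < b \/ b < 0.
  by move: b0; rewrite neq_lt => /orP[]; [right|left].
- have -> : f @^-1` `]x, y] = `](x - a) / b, (y - a) / b]%classic.
    apply/seteqP; split => s /=; rewrite !in_itv/= /f ltr_pdivrMr// ler_pdivlMr//;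
    by rewrite ltrBlDl lerBrDl [s * b]mulrC.
  rewrite !lebesgue_measure_itv/= !lte_fin ltr_pM2r ?invr_gt0// ltrD2r.
  case: ifPn => xy; last by rewrite mule0.
  rewrite -!EFinD -EFinM gtr0_norm//; congr EFin; field.
  by rewrite gt_eqF.
- have -> : f @^-1` `]x, y] = `[(y - a) / b, (x - a) / b[%classic.
    apply/seteqP; split => s /=; rewrite !in_itv/= /f ler_ndivrMr// ltr_ndivlMr//;
    by rewrite ltrBlDl lerBrDl [s * b]mulrC andbC.
  rewrite !lebesgue_measure_itv/= !lte_fin ltr_nM2r ?invr_lt0// ltrD2r.
  case: ifPn => xy; last by rewrite mule0.
  rewrite -!EFinD -EFinM ltr0_norm//; congr EFin; field.
  by rewrite lt_eqF.
Qed.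

Lemma ge0_integral_affine (a b : R) (g : measurableTypeR R -> \bar R) : b != 0 ->
  measurable_fun setT g -> (forall s, 0 <= g s)%E ->
  (\int[leb]_s g s = `|b|%:E * \int[leb]_s g (a + b * s)%R)%E.
Proof.
move=> b0 mg g0.
pose f : measurableTypeR R -> measurableTypeR R := fun s => a + b * s.
have mf : measurable_fun setT f by exact: measurable_affine.
pose nb : {nonneg R} := NngNum (normr_ge0 b).
rewrite (eq_measure_integral (mscale nb (pushforward leb f : {measure set _ -> \bar R}))).
  rewrite ge0_integral_mscale// ge0_integral_pushforward//.
by move=> A mA _; exact: lebesgue_affine.
Qed.

Lemma ge0_integral_shift (a : R) (g : measurableTypeR R -> \bar R) :
  measurable_fun setT g -> (forall s, 0 <= g s)%E ->
  (\int[leb]_s g s = \int[leb]_s g (a + s)%R)%E.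
Proof.
move=> mg g0; rewrite (@ge0_integral_affine a 1)// normr1 mul1e.
by under eq_integral do rewrite mul1r.
Qed.

End line.

Section rV.
Variable R : realType.
Local Notation leb := (@lebesgue_measure R).
Local Notation lebd d := (lebesgue_rV R d).

Lemma measurable_addr_rV d (v : 'rV[R]_d) :
  measurable_fun setT (fun x : 'rV[R]_d => x + v).
Proof.
apply: measurable_fun_rVP => i.
rewrite (_ : _ \o _ = fun x => rV_coord i x + v ord0 i); last first.
  by apply/funext => x /=; rewrite /rV_coord mxE.
apply: measurable_funD; [exact: measurable_rV_coord|exact: measurable_cst].
Qed.

(** The form in which R^(d+1) = R * R^d serves inductions on the dimension. *)
Lemma lebesgue_rVS d (A : set 'rV[R]_d.+1) :
  lebd d.+1 A = (\int[leb]_t lebd d [set y | A (cons_rV (t, y))])%E.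
Proof.
rewrite /= /lebesgue_rV_step /pushforward /product_measure1.
apply: eq_integral => t _ /=; congr (lebesgue_rV R d _).
by apply/seteqP; split => y; rewrite /xsection /= ?inE.
Qed.

Lemma cons_rVD d (a b : R) (v w : 'rV[R]_d) :
  cons_rV (a, v) + cons_rV (b, w) = cons_rV (a + b, v + w).
Proof. by apply/rowP => i; rewrite !mxE; case: unliftP => [j|] _ /=; rewrite ?mxE. Qed.

Lemma uncons_rVK d : cancel (@uncons_rV R d) (@cons_rV R d).
Proof.
move=> x; apply/rowP => i; rewrite /uncons_rV !mxE.
by case: unliftP => [j|] -> /=; rewrite ?mxE.
Qed.

Lemma measurable_section_rV d (A : set 'rV[R]_d.+1) (t : R) : measurable A ->
  measurable [set y : 'rV[R]_d | A (cons_rV (t, y))].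
Proof.
move=> mA.
have mf : measurable_fun setT (fun y : 'rV[R]_d => cons_rV (t : measurableTypeR R, y)).
  apply: (@measurableT_comp _ _ _ _ _ _ (@cons_rV R d)); first exact: measurable_cons_rV.
  exact: pair1_measurable.
by rewrite -[X in measurable X]setTI; exact: mf.
Qed.

Lemma measurable_lebesgue_section d (A : set 'rV[R]_d.+1) : measurable A ->
  measurable_fun setT (fun t : measurableTypeR R => lebd d [set y | A (cons_rV (t, y))]).
Proof.
move=> mA.
have mA' : measurable (@cons_rV R d @^-1` A).
  by rewrite -[X in measurable X]setTI; exact: measurable_cons_rV.
have := measurable_fun_xsection (lebesgue_rV R d) mA'.
apply: eq_measurable_fun => t _ /=; congr (lebesgue_rV R d _).
by apply/seteqP; split => y; rewrite /xsection /= ?inE.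
Qed.

(** The slices of a translate are translates of slices, taken at shifted
    positions; so the translation in the first coordinate acts on the line only,
    and the others are covered by induction. *)
Lemma lebesgue_rV_translate d (v : 'rV[R]_d) (A : set 'rV[R]_d) : measurable A ->
  lebd d ((fun x => x + v) @^-1` A) = lebd d A.
Proof.
elim: d v A => [|d IH] v A mA.
  by congr (lebesgue_rV _ _ _); apply/funext => x /=; congr (A _); rewrite [LHS]thinmx0 [RHS]thinmx0.
rewrite !lebesgue_rVS.
rewrite [RHS](@ge0_integral_shift _ (v ord0 ord0)) //; last exact: measurable_lebesgue_section.
apply: eq_integral => t _.
pose w : 'rV[R]_d := (uncons_rV v).2.
rewrite -[RHS](IH w); last exact: measurable_section_rV.
congr (lebesgue_rV _ _ _); apply/funext => y /=.
by rewrite -{1}[v]uncons_rVK /w cons_rVD addrC.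
Qed.

End rV.

(** * Linear changes of variables of rank one *)

Section dot_theory.
Variables (R : realType) (d : nat).
Implicit Types x y n : 'rV[R]_d.

Lemma dotDr n x y : dot n (x + y) = dot n x + dot n y.
Proof. by rewrite /dot -big_split; apply: eq_bigr => i _; rewrite mxE mulrDr. Qed.

Lemma dotZr n (a : R) x : dot n (a *: x) = a * dot n x.
Proof. by rewrite /dot mulr_sumr; apply: eq_bigr => i _; rewrite mxE mulrCA. Qed.

Lemma dotC x y : dot x y = dot y x.
Proof. by apply: eq_bigr => i _; rewrite mulrC. Qed.

Lemma dotNr n x : dot n (- x) = - dot n x.
Proof. by rewrite -scaleN1r dotZr mulN1r. Qed.

Lemma dotBr n x y : dot n (x - y) = dot n x - dot n y.
Proof. by rewrite dotDr dotNr. Qed.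

Lemma dotNl n x : dot (- n) x = - dot n x.
Proof. by rewrite dotC dotNr dotC. Qed.

Lemma dotDl n x y : dot (x + y) n = dot x n + dot y n.
Proof. by rewrite dotC dotDr !(dotC n). Qed.

Lemma dotZl n (a : R) x : dot (a *: x) n = a * dot x n.
Proof. by rewrite dotC dotZr dotC. Qed.

Lemma dot_gt0 x : x != 0 -> 0 < dot x x.
Proof.
move=> x0; rewrite lt_neqAle sumr_ge0 ?andbT; last by move=> i _; rewrite -expr2 sqr_ge0.
apply: contra x0 => /eqP/esym/eqP; rewrite psumr_eq0; last by move=> i _; rewrite -expr2 sqr_ge0.
move=> /allP h; apply/eqP/rowP => i; rewrite mxE.
have := h i; rewrite mem_index_enum => /(_ isT)/=.
by rewrite mulf_eq0 orbb => /eqP.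
Qed.

End dot_theory.

Section change_of_variables.
Variables (R : realType) (d : nat).
Local Notation leb := (@lebesgue_measure R).
Local Notation lebd := (lebesgue_rV R d).
Local Open Scope ereal_scope.

Lemma measurable_dot (n : 'rV[R]_d) :
  measurable_fun setT (fun x : 'rV[R]_d => dot n x).
Proof.
rewrite /dot; apply: measurable_sum => i.
by apply: measurable_funM; [exact: measurable_cst|exact: (measurable_rV_coord i)].
Qed.

Lemma measurable_line (w : 'rV[R]_d) :
  measurable_fun setT (fun p : 'rV[R]_d * measurableTypeR R => (p.1 + p.2 *: w)%R).
Proof.
apply: measurable_fun_rVP => i.
rewrite (_ : _ \o _ = fun p => (rV_coord i p.1 + p.2 * w ord0 i)%R); last first.
  by apply/funext => x /=; rewrite /rV_coord !mxE.
apply: measurable_funD.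
  by apply: measurableT_comp; [exact: measurable_rV_coord|exact: measurable_fst].
by apply: measurable_funM; [exact: measurable_snd|exact: measurable_cst].
Qed.

Lemma ge0_integral_translate (v : 'rV[R]_d) (g : 'rV[R]_d -> \bar R) :
  measurable_fun setT g -> (forall x, 0 <= g x) ->
  \int[lebd]_x g (x + v)%R = \int[lebd]_x g x.
Proof.
move=> mg g0.
have mf := measurable_addr_rV v.
rewrite [RHS](eq_measure_integral (pushforward lebd (fun x => x + v)%R : {measure set _ -> \bar R})).
  by rewrite ge0_integral_pushforward.
by move=> A mA _; apply/esym; exact: lebesgue_rV_translate.
Qed.

(** An affine map whose linear part is the identity plus a map of rank one, with
    determinant 1 + dot n w. Translations, projections on a hyperplane and the
    map that makes an oblique prism upright are all of this form. *)
Definition slide (n w : 'rV[R]_d) (c : R) (x : 'rV[R]_d) : 'rV[R]_d :=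
  (x + (dot n x - c) *: w)%R.

Lemma measurable_slide n w c : measurable_fun setT (slide n w c).
Proof.
rewrite /slide; apply: (@measurableT_comp _ _ _ _ _ _
  (fun p : 'rV[R]_d * measurableTypeR R => (p.1 + p.2 *: w)%R) _ (fun x => (x, (dot n x - c)%R))).
  exact: measurable_line.
apply: measurable_fun_pair; first exact: measurable_id.
apply: measurable_funB; [exact: measurable_dot|exact: measurable_cst].
Qed.

Lemma integral_unit_indic (a : R) :
  \int[leb]_s (\1_(`[0%R, 1%R]%classic : set R) (s - a)%R)%:E = 1.
Proof.
pose g (s : measurableTypeR R) := (\1_(`[0%R, 1%R]%classic : set R) s)%:E : \bar R.
have mg : measurable_fun setT g by exact/measurable_EFinP/measurable_indic.
transitivity (\int[leb]_s g s).
  rewrite [RHS](@ge0_integral_shift _ (- a))//; last by move=> s; rewrite /g lee_fin.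
  by apply: eq_integral => s _; rewrite addrC.
rewrite /g integral_indic// setIT /= lebesgue_measure_itv/= lte_fin ltr01.
by rewrite -EFinD subr0.
Qed.

(** The factor is the determinant, but no determinant is computed. Average over
    the translations by s w, weighted by the indicator psi of the unit interval.
    On the line x + R w the map is affine with slope 1 + dot n w, hence a
    substitution in s; the shift that it produces depends on x and is undone by
    the translation by - s w. What remains is the total weight 1 of psi. *)
Lemma ge0_integral_slide (n w : 'rV[R]_d) (c : R) (g : 'rV[R]_d -> \bar R) :
  (1 + dot n w != 0)%R ->
  measurable_fun setT g -> (forall x, 0 <= g x) ->
  \int[lebd]_x g x =
    `|1 + dot n w|%:E * \int[lebd]_x g (slide n w c x).
Proof.
set rho := (1 + dot n w)%R; move=> rho0 mg g0.
pose psi (s : R) := (\1_(`[0%R, 1%R]%classic : set R) s)%:E : \bar R.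
have mpsi : measurable_fun setT (psi : measurableTypeR R -> \bar R).
  exact/measurable_EFinP/measurable_indic.
have psi0 s : 0 <= psi s by rewrite /psi lee_fin.
pose al x := (dot n x - c)%R.
have mal : measurable_fun setT (fun x => al x).
  by apply: measurable_funB; [exact: measurable_dot|exact: measurable_cst].
have mL := measurable_slide n w c.
have mgL : measurable_fun setT (g \o slide n w c) by exact: measurableT_comp.
have mgl : measurable_fun setT (fun p : 'rV[R]_d * measurableTypeR R => g (p.1 + p.2 *: w)%R).
  by apply: measurableT_comp => //; exact: measurable_line.
have mfst (f : 'rV[R]_d -> \bar R) : measurable_fun setT f ->
    measurable_fun setT (fun p : 'rV[R]_d * measurableTypeR R => f p.1).
  by move=> mf; apply: measurableT_comp => //; exact: measurable_fst.
have mal1 : measurable_fun setT (fun p : 'rV[R]_d * measurableTypeR R => al p.1).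
  by apply: (measurableT_comp mal); exact: measurable_fst.
have psi1 (a : R) : \int[leb]_s psi (s - a)%R = 1 by exact: integral_unit_indic.
have slideE x s : slide n w c (x + s *: w)%R = (x + (al x + rho * s) *: w)%R.
  rewrite /slide /al /rho dotDr dotZr -addrA -scalerDl; congr (_ + _ *: _)%R; ring.
(* any translate of psi has total weight 1; this one is what the translation
   by - s w makes of the weight after the substitution *)
transitivity (\int[lebd]_x \int[leb]_s (psi (s - al x / rho)%R * g x)).
  apply: eq_integral => x _; rewrite ge0_integralZr//.
  - by rewrite psi1 mul1e.
  - apply: measurableT_comp => //; apply: measurable_funB => //.
rewrite (@fubini_tonelli _ _ _ _ _ lebd leb
  (fun p => psi (p.2 - al p.1 / rho)%R * g p.1)); last 2 first.
- apply: emeasurable_funM; last exact: mfst.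
  apply: measurableT_comp => //; apply: measurable_funB; first exact: measurable_snd.
  by apply: measurable_funM.
- by move=> p; rewrite mule_ge0.
transitivity (\int[leb]_s \int[lebd]_x (psi ((s - al x) / rho)%R * g (x + s *: w)%R)).
  apply: eq_integral => s _ /=.
  rewrite -[RHS](@ge0_integral_translate (- (s *: w))%R); last 2 first.
  - apply: emeasurable_funM.
      apply: measurableT_comp => //; apply: measurable_funM => //.
      by apply: measurable_funB.
    by apply: measurableT_comp => //; exact: measurable_addr_rV.
  - by move=> x; rewrite mule_ge0.
  apply: eq_integral => x _; rewrite subrK; congr (psi _ * _).
  rewrite /al dotBr dotZr; apply: (mulIf rho0); rewrite mulrBl !divfK//.
  by rewrite /rho; ring.
rewrite -(@fubini_tonelli _ _ _ _ _ lebd leb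
  (fun p => psi ((p.2 - al p.1) / rho)%R * g (p.1 + p.2 *: w)%R)); last 2 first.
- apply: emeasurable_funM => //.
  apply: measurableT_comp => //; apply: measurable_funM => //.
  by apply: measurable_funB; first exact: measurable_snd.
- by move=> p; rewrite mule_ge0.
transitivity (\int[lebd]_x (`|rho|%:E * \int[leb]_s (psi s * g (slide n w c (x + s *: w)%R)))).
  apply: eq_integral => x _ /=.
  rewrite (@ge0_integral_affine _ (al x) rho)//; last 2 first.
  - apply: emeasurable_funM.
      apply: measurableT_comp => //; apply: measurable_funM => //.
      by apply: measurable_funB.
    apply: measurableT_comp => //; apply: (@measurableT_comp _ _ _ _ _ _
      (fun p : 'rV[R]_d * measurableTypeR R => (p.1 + p.2 *: w)%R) _
      (fun s : measurableTypeR R => (x, s))).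
      exact: measurable_line.
    exact: pair1_measurable.
  - by move=> s; rewrite mule_ge0.
  congr (_ * _); apply: eq_integral => s _; rewrite slideE; congr (psi _ * _).
  by field.
have mprod : measurable_fun setT (fun p : 'rV[R]_d * measurableTypeR R =>
    psi p.2 * g (slide n w c (p.1 + p.2 *: w)%R)).
  apply: emeasurable_funM.
    by apply: measurableT_comp => //; exact: measurable_snd.
  by apply: (measurableT_comp mgL); exact: measurable_line.
rewrite ge0_integralZl//; last 2 first.
- apply: (measurable_fun_fubini_tonelli_F _ mprod).
  by move=> p; rewrite mule_ge0.
- by move=> x _; apply: integral_ge0 => s _; rewrite mule_ge0.
congr (_ * _).
rewrite (@fubini_tonelli _ _ _ _ _ lebd leb
  (fun p => psi p.2 * g (slide n w c (p.1 + p.2 *: w)%R)))//; last first.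
  by move=> p; rewrite mule_ge0.
transitivity (\int[leb]_s (psi s * \int[lebd]_x g (slide n w c x))).
  apply: eq_integral => s _ /=; rewrite ge0_integralZl//; last first.
    by apply: (measurableT_comp mgL); exact: measurable_addr_rV.
  by congr (_ * _); exact: (ge0_integral_translate (s *: w)%R mgL (fun x => g0 _)).
rewrite ge0_integralZr//; last by apply: integral_ge0.
suff -> : \int[leb]_s psi s = 1 by rewrite mul1e.
by rewrite -(psi1 0%R); apply: eq_integral => s _; congr psi; exact: esym (subr0 _).
Qed.

(** Average over the translations by s n with s in the unit interval: a line in
    the direction n meets the hyperplane in a single point. *)
Lemma hyperplane_null (n : 'rV[R]_d) (c : R) : n != 0%R ->
  lebd [set x | dot n x = c] = 0.
Proof.
move=> n0.
have mH : measurable [set x : 'rV[R]_d | dot n x = c].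
  rewrite (_ : [set _ | _] = (fun x => dot n x) @^-1` [set c])//.
  by rewrite -[X in measurable X]setTI; apply: measurable_dot.
pose H := [set x : 'rV[R]_d | dot n x = c].
pose psi (s : R) := (\1_(`[0%R, 1%R]%classic : set R) s)%:E : \bar R.
have mpsi : measurable_fun setT (psi : measurableTypeR R -> \bar R).
  exact/measurable_EFinP/measurable_indic.
have psi0 s : 0 <= psi s by rewrite /psi lee_fin.
have m1H : measurable_fun setT (fun x : 'rV[R]_d => (\1_H x)%:E : \bar R).
  exact/measurable_EFinP/measurable_indic.
have mprod : measurable_fun setT (fun p : 'rV[R]_d * measurableTypeR R =>
    psi p.2 * (\1_H (p.1 + p.2 *: n)%R)%:E).
  apply: emeasurable_funM.
    by apply: measurableT_comp => //; exact: measurable_snd.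
  by apply: (measurableT_comp m1H); exact: measurable_line.
transitivity (\int[leb]_s (psi s * \int[lebd]_x (\1_H x)%:E)).
  rewrite integral_indic// setIT ge0_integralZr//.
  suff -> : \int[leb]_s psi s = 1 by rewrite mul1e.
  by rewrite -(integral_unit_indic 0%R); apply: eq_integral => s _; congr psi; exact: esym (subr0 _).
transitivity (\int[leb]_s \int[lebd]_x (psi s * (\1_H (x + s *: n)%R)%:E)).
  apply: eq_integral => s _; rewrite ge0_integralZl//; last first.
    by apply: (measurableT_comp m1H); exact: measurable_addr_rV.
  by congr (_ * _); rewrite (@ge0_integral_translate (s *: n)%R (fun x => (\1_H x)%:E)).
rewrite -(@fubini_tonelli _ _ _ _ _ lebd leb
  (fun p => psi p.2 * (\1_H (p.1 + p.2 *: n)%R)%:E))//; last first.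
  by move=> p; rewrite mule_ge0.
rewrite integral0_eq// => x _ /=.
pose t0 := ((c - dot n x) / dot n n)%R.
have nn0 : dot n n != 0%R by rewrite gt_eqF// dot_gt0.
rewrite (eq_integral (fun s => psi t0 * (\1_[set t0 : measurableTypeR R] s)%:E)).
  rewrite ge0_integralZl//; last exact/measurable_EFinP/measurable_indic.
  by rewrite integral_indic// setIT /= lebesgue_measure_set1 mule0.
move=> s _; have [->|st] := eqVneq s t0.
  by rewrite /H !indicE !mem_set// /= dotDr dotZr /t0 divfK// addrC subrK.
rewrite !indicE !memNset ?mule0//= => [/eqP|]; first exact/negP.
rewrite /H /= dotDr dotZr => e; move/eqP: st; apply.
by rewrite /t0 -e addrC addKr mulfK.
Qed.

End change_of_variables.

(** * Integrable functions with bounded support *)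

Section bounded.
Variables (R : realType) (V : normedModType R).

Lemma bounded_onP (T : Type) (f : T -> V) (A : set T) :
  [bounded f x | x in A] <-> exists M : R, forall x, A x -> `|f x| <= M.
Proof.
split=> [/(@filter_ex _ _ proper_pinfty_nbhs)[M fM]|[M fM]]; first by exists M.
rewrite /bounded_near; near=> N => x Ax /=.
by apply: le_trans (fM _ Ax) _; near: N; apply: nbhs_pinfty_ge; exact: num_real.
Unshelve. all: by end_near. Qed.

End bounded.

Section Rintegral_sum.
Context dT (T : measurableType dT) (R : realType) (mu : {measure set T -> \bar R}).
Variables (D : set T) (I : Type) (P : pred I) (F : I -> T -> R).
Hypothesis mD : measurable D.
Hypothesis iF : forall i, P i -> mu.-integrable D (EFin \o F i).

Let integrable_Rintegral_sum (s : seq I) :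
  mu.-integrable D (EFin \o (fun x => \sum_(i <- s | P i) F i x)) /\
  \int[mu]_(x in D) (\sum_(i <- s | P i) F i x) =
    \sum_(i <- s | P i) \int[mu]_(x in D) F i x.
Proof.
elim: s => [|i s [IH1 IH2]].
  rewrite big_nil; split.
    by apply: (eq_integrable _ (cst 0%E)) => //; [move=> x _ /=; rewrite big_nil|exact: integrable0].
  by rewrite -[RHS](mul0r (fine (mu D))) -Rintegral_cst//; apply: eq_Rintegral => x _; rewrite big_nil.
have -> : (fun x => \sum_(i <- i :: s | P i) F i x) = (fun x =>
    if P i then F i x + \sum_(i <- s | P i) F i x else \sum_(i <- s | P i) F i x).
  by apply/funext => x; rewrite big_cons.
rewrite big_cons; case: (P i) (@iF i) => // /(_ isT) hi; split.
  exact: (integrableD _ hi IH1).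
by rewrite RintegralD ?IH2.
Qed.

Lemma integrable_Rsum (s : seq I) :
  mu.-integrable D (EFin \o (fun x => \sum_(i <- s | P i) F i x)).
Proof. by have [] := integrable_Rintegral_sum s. Qed.

Lemma Rintegral_sum (s : seq I) :
  \int[mu]_(x in D) (\sum_(i <- s | P i) F i x) =
    \sum_(i <- s | P i) \int[mu]_(x in D) F i x.
Proof. by have [] := integrable_Rintegral_sum s. Qed.

End Rintegral_sum.

Section norm_rV.
Variable R : realType.

Lemma coord_le_norm d (x : 'rV[R]_d) (i : 'I_d) : `|x ord0 i| <= `|x|.
Proof.
rewrite [leRHS]/Num.norm/= mx_normrE.
exact: (le_bigmax _ (fun ij : 'I_1 * 'I_d => `|x ij.1 ij.2|) (ord0, i)).
Qed.

Lemma norm_le_coord d (x : 'rV[R]_d) (M : R) : 0 <= M ->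
  (forall i, `|x ord0 i| <= M) -> `|x| <= M.
Proof.
move=> M0 h; rewrite [leLHS]/Num.norm/= mx_normrE; apply: bigmax_le => //.
by move=> [i j] _ /=; rewrite ord1.
Qed.

Lemma norm_dot_le d (n x : 'rV[R]_d) : `|dot n x| <= (\sum_i `|n ord0 i|) * `|x|.
Proof.
rewrite /dot mulr_suml; apply: le_trans (ler_norm_sum _ _ _) _.
by apply: ler_sum => i _; rewrite normrM ler_wpM2l// coord_le_norm.
Qed.

Lemma norm_slide_le d (n w : 'rV[R]_d) c (M : R) x : `|x| <= M ->
  `|slide n w c x| <= M + ((\sum_i `|n ord0 i|) * M + `|c|) * `|w|.
Proof.
move=> xM; rewrite /slide; apply: le_trans (ler_normD _ _) _.
apply: lerD => //; rewrite normrZ ler_wpM2r//.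
apply: le_trans (ler_normB _ _) _; rewrite lerD2r.
apply: le_trans (norm_dot_le _ _) _; rewrite ler_wpM2l//.
by apply: sumr_ge0 => i _.
Qed.

End norm_rV.

Section cubes.
Variable R : realType.
Local Notation leb := (@lebesgue_measure R).
Local Notation lebd d := (lebesgue_rV R d).

Definition cube d (c : 'rV[R]_d) (r : R) : set 'rV[R]_d :=
  [set x | forall i, x ord0 i \in `[c ord0 i - r, c ord0 i + r]].

Lemma measurable_cube d (c : 'rV[R]_d) (r : R) : measurable (cube c r).
Proof.
rewrite (_ : cube c r = \bigcap_(i in [set: 'I_d])
    [set x : 'rV[R]_d | rV_coord i x \in `[c ord0 i - r, c ord0 i + r]]); last first.
  by apply/seteqP; split => x h i; [move=> _; exact: h|exact: (h i I)].
apply: fin_bigcap_measurable => //= i _.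
rewrite -[X in measurable X]setTI; apply: (measurable_rV_coord i measurableT
  (Y := `[c ord0 i - r, c ord0 i + r]%classic)); exact: measurable_itv.
Qed.

Lemma lebesgue_cube d (c : 'rV[R]_d) (r : R) : 0 <= r ->
  lebd d (cube c r) = ((r *+ 2) ^+ d)%:E.
Proof.
move=> r0; elim: d c => [|d IH] c.
  rewrite /= expr0 diracE mem_set//.
  by case.
rewrite lebesgue_rVS.
pose c' : 'rV[R]_d := (uncons_rV c).2.
rewrite (eq_integral (fun t : measurableTypeR R =>
    (\1_(`[c ord0 ord0 - r, c ord0 ord0 + r]%classic : set R) t)%:E *
      ((r *+ 2) ^+ d)%:E)%E); last first.
  move=> t _.
  have cubeE : [set y | cube c r (cons_rV (t : measurableTypeR R, y))] =
      [set y | t \in `[c ord0 ord0 - r, c ord0 ord0 + r] /\ cube c' r y].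
    apply/seteqP; split => y /=.
      move=> h; split; first by have := h ord0; rewrite mxE unlift_none.
      by move=> i; have := h (lift ord0 i); rewrite !mxE liftK.
    move=> [h1 h2] i; rewrite mxE; case: unliftP => [j|] -> //=.
    by have := h2 j; rewrite !mxE.
  rewrite cubeE indicE; case: (boolP (t \in `[c ord0 ord0 - r, c ord0 ord0 + r])) => ht.
    rewrite mem_set//= mul1e -(IH c'); congr (lebesgue_rV _ _ _).
    by apply/seteqP; split => y //= [].
  rewrite memNset//= ?mul0e; last exact/negP.
  rewrite -(@measure0 _ _ _ (lebesgue_rV R d)); congr (lebesgue_rV _ _ _).
  by apply/seteqP; split => y //= [].
rewrite ge0_integralZr//; last 2 first.
- exact/measurable_EFinP/measurable_indic.
- by rewrite lee_fin exprn_ge0// mulrn_wge0.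
rewrite integral_indic// setIT /= lebesgue_measure_itv/= lte_fin ltrD2l -EFinD.
rewrite exprS EFinM; congr (_ * _)%E.
have -> : c ord0 ord0 + r - (c ord0 ord0 - r) = r *+ 2 by ring.
case: ltP => // h; congr EFin.
by apply/eqP; rewrite eq_sym mulrn_eq0/= eq_le r0 andbT; lra.
Qed.

Lemma sub_cube d (A : set 'rV[R]_d) (M : R) : (forall x, A x -> `|x| <= M) ->
  A `<=` cube 0 M.
Proof.
move=> AM x Ax i; rewrite in_itv/= mxE sub0r add0r -ler_norml.
exact: le_trans (coord_le_norm _ _) (AM _ Ax).
Qed.

Lemma lebesgue_bounded d (A : set 'rV[R]_d) : bounded_set A -> measurable A ->
  (lebd d A < +oo)%E.
Proof.
move=> /bounded_onP[M AM] mA.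
apply: (@le_lt_trans _ _ (lebd d (cube 0 (Num.max M 0)))); last first.
  by rewrite lebesgue_cube ?ltry// le_max lexx orbT.
apply: le_measure; [by rewrite inE|by rewrite inE; exact: measurable_cube|].
by apply: sub_cube => x /AM; rewrite le_max => ->.
Qed.

Lemma lebesgue_open_gt0 d (A : set 'rV[R]_d) : open A -> A !=set0 -> measurable A ->
  (0 < lebd d A)%E.
Proof.
move=> oA [x Ax] mA.
have /nbhs_ballP[e/= e0 eA] : nbhs x A by exact: open_nbhs_nbhs.
apply: (@lt_le_trans _ _ (lebd d (cube x (e / 2)))).
  by rewrite lebesgue_cube ?lte_fin ?exprn_gt0//; lra.
apply: le_measure; [by rewrite inE; exact: measurable_cube|by rewrite inE|].
move=> y xy; apply: eA; rewrite mx_norm_ball /ball_/=.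
apply: (@le_lt_trans _ _ (e / 2)); last lra.
apply: norm_le_coord; first lra.
move=> i; have := xy i; rewrite in_itv/= !mxE ler_norml => /andP[h1 h2].
by apply/andP; split; lra.
Qed.

End cubes.

Section locally_bounded.
Variables (R : realType) (d : nat).
Local Notation lebd := (lebesgue_rV R d).
Implicit Types f g : 'rV[R]_d -> R.

(** A class that is closed under the operations needed below and whose members
    are integrable on bounded measurable sets, so that integrability is settled
    by the shape of the integrand. *)
Definition locally_bounded f :=
  measurable_fun setT f /\
  forall M : R, exists N : R, forall x, `|x| <= M -> `|f x| <= N.

Lemma locally_bounded_cst (a : R) : locally_bounded (fun=> a).
Proof. by split => // M; exists `|a|. Qed.

Lemma locally_bounded_coord (i : 'I_d) : locally_bounded (fun x => x ord0 i).
Proof.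
split; first exact: (measurable_rV_coord i).
by move=> M; exists M => x; apply: le_trans; exact: coord_le_norm.
Qed.

Lemma locally_boundedD f g : locally_bounded f -> locally_bounded g ->
  locally_bounded (fun x => f x + g x).
Proof.
move=> [mf bf] [mg bg]; split; first exact: measurable_funD.
move=> M; have [N hN] := bf M; have [P hP] := bg M; exists (N + P) => x xM.
by apply: le_trans (ler_normD _ _) _; apply: lerD; [exact: hN|exact: hP].
Qed.

Lemma locally_boundedM f g : locally_bounded f -> locally_bounded g ->
  locally_bounded (fun x => f x * g x).
Proof.
move=> [mf bf] [mg bg]; split; first exact: measurable_funM.
move=> M; have [N hN] := bf M; have [P hP] := bg M; exists (N * P) => x xM.
by rewrite normrM ler_pM//; [exact: hN|exact: hP].
Qed.

Lemma locally_boundedB f g : locally_bounded f -> locally_bounded g ->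
  locally_bounded (fun x => f x - g x).
Proof.
move=> bf bg; apply: locally_boundedD => //.
rewrite (_ : (fun x => - g x) = fun x => (-1) * g x); last by apply/funext => x; rewrite mulN1r.
by apply: locally_boundedM => //; exact: locally_bounded_cst.
Qed.

Lemma locally_bounded_sum (I : Type) (s : seq I) (P : pred I) (F : I -> 'rV[R]_d -> R) :
  (forall i, P i -> locally_bounded (F i)) ->
  locally_bounded (fun x => \sum_(i <- s | P i) F i x).
Proof.
move=> h; elim: s => [|i s IH].
  rewrite (_ : (fun _ => _) = fun=> 0); first exact: locally_bounded_cst.
  by apply/funext => x; rewrite big_nil.
rewrite (_ : (fun _ => _) = fun x => if P i then F i x + \sum_(i <- s | P i) F i x
    else \sum_(i <- s | P i) F i x); last first.
  by apply/funext => x; rewrite big_cons.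
by case: (P i) (h i) => // hi; apply: locally_boundedD => //; exact: hi.
Qed.

Lemma locally_bounded_indic (A : set 'rV[R]_d) : measurable A ->
  locally_bounded (\1_A).
Proof.
move=> mA; split; first exact: measurable_indic.
by move=> M; exists 1 => x _; rewrite indicE ger0_norm// lern1; case: (_ \in _).
Qed.

Lemma locally_bounded_slide (n w : 'rV[R]_d) c f : locally_bounded f ->
  locally_bounded (fun x => f (slide n w c x)).
Proof.
move=> [mf bf]; split; first exact: (measurableT_comp mf (measurable_slide _ _ _)).
move=> M; have [N hN] := bf (M + ((\sum_i `|n ord0 i|) * M + `|c|) * `|w|).
by exists N => x xM; apply: hN; exact: norm_slide_le.
Qed.

Lemma integrable_indicM (A : set 'rV[R]_d) f : measurable A -> bounded_set A ->
  locally_bounded f -> lebd.-integrable setT (EFin \o (fun x => \1_A x * f x)).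
Proof.
move=> mA bA [mf bf].
have : lebd.-integrable A (EFin \o f).
  apply: measurable_bounded_integrable => //.
  - exact: lebesgue_bounded.
  - exact: measurable_funTS.
  - have /bounded_onP[M AM] := bA; have [N hN] := bf M.
    by apply/bounded_onP; exists N => x Ax; apply: hN; exact: AM.
move/(integrable_mkcond _ mA); apply: eq_integrable => // x _.
by rewrite /patch /= indicE; case: ifPn => xA /=; rewrite ?mul1r ?mul0r.
Qed.

Lemma Rintegral_indic (A : set 'rV[R]_d) f :
  \int[lebd]_(x in A) f x = \int[lebd]_x (\1_A x * f x).
Proof.
rewrite Rintegral_mkcond; apply: eq_Rintegral => x _.
by rewrite /patch indicE; case: ifPn => xA /=; rewrite ?mul1r ?mul0r.
Qed.

(** Positive and negative parts commute with the change of variables. *)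
Lemma Rintegral_slide (n w : 'rV[R]_d) (c : R) f : 1 + dot n w != 0 ->
  lebd.-integrable setT (EFin \o f) ->
  lebd.-integrable setT (EFin \o (fun x => f (slide n w c x))) /\
  \int[lebd]_x f x = `|1 + dot n w| * \int[lebd]_x f (slide n w c x).
Proof.
move=> rho0 intf.
have mf : measurable_fun setT (EFin \o f) by exact: (measurable_int lebd).
have mL := measurable_slide n w c.
have rho_gt0 : 0 < `|1 + dot n w| by rewrite normr_gt0.
have intL : lebd.-integrable setT (EFin \o (fun x => f (slide n w c x))).
  apply/integrableP; split; first exact: (measurableT_comp mf mL).
  move/integrableP : intf => [_].
  rewrite (@ge0_integral_slide _ _ n w c (abse \o (EFin \o f)))//; last 2 first.
  - by apply: measurableT_comp => //; exact: abse_measurable.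
  - by move=> x; exact: abse_ge0.
  move=> h; rewrite -(@lte_pmul2l _ `|1 + dot n w|%:E) ?lte_fin//.
  by rewrite gt0_muley ?lte_fin.
split => //.
rewrite /Rintegral integralE [in RHS]integralE.
have hp : (\int[lebd]_x (EFin \o f)^\+ x =
   `|1 + dot n w|%:E * \int[lebd]_x (EFin \o (fun x => f (slide n w c x)))^\+ x)%E.
  rewrite (ge0_integral_slide c rho0 (measurable_funepos mf) (fun=> funepos_ge0 _ _)).
  by congr (_ * _)%E; apply: eq_integral => x _; rewrite !funeposE.
have hn : (\int[lebd]_x (EFin \o f)^\- x =
   `|1 + dot n w|%:E * \int[lebd]_x (EFin \o (fun x => f (slide n w c x)))^\- x)%E.
  rewrite (ge0_integral_slide c rho0 (measurable_funeneg mf) (fun=> funeneg_ge0 _ _)).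
  by congr (_ * _)%E; apply: eq_integral => x _; rewrite !funenegE.
rewrite hp hn -muleBr//.
  rewrite fineM// fin_numB.
  by rewrite !integrable_fin_num//; [exact: integrable_funeneg|exact: integrable_funepos].
by rewrite fin_num_adde_defl// fin_numN integrable_fin_num//; exact: integrable_funeneg.
Qed.

Lemma Rintegral_translate (v : 'rV[R]_d) f :
  lebd.-integrable setT (EFin \o f) ->
  lebd.-integrable setT (EFin \o (fun x => f (x + v))) /\
  \int[lebd]_x f (x + v) = \int[lebd]_x f x.
Proof.
move=> intf.
have d0 : dot 0 (- v) = 0 by rewrite /dot big1// => i _; rewrite mxE mul0r.
(* with n = 0 the height is the constant - c, which turns a slide into a translation *)
have E x : slide 0 (- v) 1 x = x + v.
  by rewrite /slide /dot big1 ?sub0r ?scaleN1r ?opprK// => i _; rewrite mxE mul0r.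
have := @Rintegral_slide 0 (- v) 1 f.
rewrite d0 addr0 oner_eq0 => /(_ isT intf).
rewrite normr1 mul1r => -[i1 i2]; split.
  by move: i1; rewrite (_ : (fun x => f (slide 0 (- v) 1 x)) = fun x => f (x + v))//;
    apply/funext => x; rewrite E.
by rewrite i2; apply: eq_Rintegral => x _; rewrite E.
Qed.

End locally_bounded.

(** * Polynomial functions *)

Section polynomials.
Variables (R : realType) (d : nat).
Implicit Types f g : 'rV[R]_d -> R.
Local Notation lebd := (lebesgue_rV R d).

Definition is_polynomial f := exists p : mpoly.mpoly d R,
  f = (fun x => mpoly.meval (x ord0) p).

Lemma polynomial_fun_is_polynomial r f : polynomial_fun r f -> is_polynomial f.
Proof. by move=> [p [_ ->]]; exists p. Qed.

Lemma is_polynomialM f g : is_polynomial f -> is_polynomial g ->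
  is_polynomial (fun x => f x * g x).
Proof.
move=> [p ->] [q ->]; exists (p * q).
by apply/funext => x; rewrite mpoly.mevalM.
Qed.

(** The analytic properties of polynomials are proved on generators by means of
    this principle, never on coefficients. *)
Lemma is_polynomial_ind (P : ('rV[R]_d -> R) -> Prop) :
  (forall c, P (fun=> c)) -> (forall i, P (fun x => x ord0 i)) ->
  (forall f g, P f -> P g -> P (fun x => f x + g x)) ->
  (forall f g, P f -> P g -> P (fun x => f x * g x)) ->
  forall f, is_polynomial f -> P f.
Proof.
move=> Pc Px PD PM f [p ->].
rewrite (_ : (fun _ => _) = fun x : 'rV[R]_d =>
    \sum_(m <- mpoly.msupp p) mpoly.mcoeff m p * \prod_i x ord0 i ^+ (m i)); last first.
  by apply/funext => x; rewrite mpoly.mevalE.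
elim: (mpoly.msupp p : seq _) => [|m s IH].
  by rewrite (_ : (fun _ => _) = fun=> 0) //; apply/funext => x; rewrite big_nil.
rewrite (_ : (fun _ => _) = fun x : 'rV[R]_d =>
  mpoly.mcoeff m p * \prod_i x ord0 i ^+ (m i) +
    \sum_(m <- s) mpoly.mcoeff m p * \prod_i x ord0 i ^+ (m i)); last first.
  by apply/funext => x; rewrite big_cons.
apply: (PD) => //; apply: (PM (fun=> mpoly.mcoeff m p)) => //.
elim: (index_enum _) => [|i t IHt].
  by rewrite (_ : (fun _ => _) = fun=> 1) //; apply/funext => x; rewrite big_nil.
rewrite (_ : (fun _ => _) = fun x : 'rV[R]_d =>
  x ord0 i ^+ (m i) * \prod_(i <- t) x ord0 i ^+ (m i)); last first.
  by apply/funext => x; rewrite big_cons.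
apply: (PM) => //; elim: (m i) => [|k IHk].
  by rewrite (_ : (fun _ => _) = fun=> 1) //; apply/funext => x; rewrite expr0.
rewrite (_ : (fun _ => _) = fun x : 'rV[R]_d => x ord0 i * x ord0 i ^+ k); last first.
  by apply/funext => x; rewrite exprS.
exact: (PM (fun x => x ord0 i)).
Qed.

Lemma locally_bounded_polynomial f : is_polynomial f -> locally_bounded f.
Proof.
move: f; apply: is_polynomial_ind => [c|i|f g|f g].
- exact: locally_bounded_cst.
- exact: locally_bounded_coord.
- exact: locally_boundedD.
- exact: locally_boundedM.
Qed.

(** On lines, derivatives and roots become those of univariate polynomials. *)
Lemma polynomial_line f : is_polynomial f -> forall x u, exists q : {poly R},
  forall t, f (x + t *: u) = q.[t].
Proof.
move: f; apply: is_polynomial_ind => [c|i|f g hf hg|f g hf hg] x u.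
- by exists c%:P => t; rewrite hornerC.
- by exists ((x ord0 i)%:P + (u ord0 i)%:P * 'X) => t; rewrite !hornerE !mxE mulrC.
- have [p hp] := hf x u; have [q hq] := hg x u; exists (p + q) => t.
  by rewrite hp hq hornerD.
- have [p hp] := hf x u; have [q hq] := hg x u; exists (p * q) => t.
  by rewrite hp hq hornerM.
Qed.

Lemma is_derive_line f (x u : 'rV[R]_d) (q : {poly R}) :
  (forall t, f (x + t *: u) = q.[t]) -> forall t,
  is_derive (x + t *: u) u f q^`().[t].
Proof.
move=> fq t.
have E : (fun h : R => h^-1 *: ((f \o shift (x + t *: u)) (h *: u) - f (x + t *: u))) =
   (fun h : R => h^-1 *: ((horner q \o shift t) (h *: (1 : R)) - q.[t])).
  apply/funext => h /=; congr (_ *: (_ - _)); last by rewrite fq.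
  rewrite -fq [h *: 1]mulr1 addrCA -scalerDl; congr (f (_ + _ *: _)).
have [d1 d2] := is_derive_poly q t.
apply: DeriveDef.
  by move: d1; rewrite /derivable E.
by move: d2; rewrite /derive E.
Qed.

Lemma derivable_polynomial f x u : is_polynomial f -> derivable f x u.
Proof.
move=> pf; have [q hq] := polynomial_line pf x u.
have := is_derive_line hq 0; rewrite scale0r addr0.
by move=> [].
Qed.

(** The product rule involves the factors as well as their derivatives, and it
    requires derivability: the induction carries the three properties. *)
Lemma locally_bounded_derive f u : is_polynomial f ->
  locally_bounded (fun x => 'D_u f x).
Proof.
move=> pf; suff [_ _ //] : [/\ forall x, derivable f x u, locally_bounded f &
    locally_bounded (fun x => 'D_u f x)].
move: f pf; apply: is_polynomial_ind => [c|i|f g [df bf bdf] [dg bg bdg]|f g [df bf bdf] [dg bg bdg]].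
- split => [x||]; [exact: derivable_cst|exact: locally_bounded_cst|].
  suff -> : (fun x => 'D_u (fun=> c) x) = fun=> 0 by exact: locally_bounded_cst.
  by apply/funext => x; rewrite derive_cst.
- have pX : is_polynomial (fun x => x ord0 i).
    by exists (mpoly.mpolyX R (mpoly.mnm1 i)); apply/funext => x; rewrite mpoly.mevalXU.
  split => [x||]; [exact: derivable_polynomial|exact: locally_bounded_coord|].
  suff -> : (fun x => 'D_u (fun y : 'rV[R]_d => y ord0 i) x) = fun=> u ord0 i.
    exact: locally_bounded_cst.
  apply/funext => x.
  have hq t : (x + t *: u) ord0 i = ((x ord0 i)%:P + (u ord0 i)%:P * 'X).[t].
    by rewrite !hornerE !mxE mulrC.
  have [_] := @is_derive_line (fun x => x ord0 i) x u _ hq 0.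
  rewrite scale0r addr0 => ->.
  by rewrite derivD derivC add0r derivM derivC mul0r add0r derivX mulr1 hornerC.
- split => [x||]; [exact: derivableD|exact: locally_boundedD|].
  suff -> : (fun x => 'D_u (fun y => f y + g y) x) = fun x => 'D_u f x + 'D_u g x.
    exact: locally_boundedD.
  by apply/funext => x; rewrite deriveD.
- split => [x||]; [exact: derivableM|exact: locally_boundedM|].
  suff -> : (fun x => 'D_u (fun y => f y * g y) x) = fun x => f x * 'D_u g x + g x * 'D_u f x.
    by apply: locally_boundedD; apply: locally_boundedM.
  by apply/funext => x; rewrite deriveM.
Qed.

Lemma deriveM_polynomial f g u x : is_polynomial f -> is_polynomial g ->
  'D_u (fun y => f y * g y) x = f x * 'D_u g x + g x * 'D_u f x.
Proof.
by move=> pf pg; rewrite deriveM//; exact: derivable_polynomial.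
Qed.

Lemma continuous_polynomial f : is_polynomial f -> continuous f.
Proof.
move: f; apply: is_polynomial_ind => [c|i|f g hf hg|f g hf hg] x.
- exact: cst_continuous.
- exact: coord_continuous.
- exact: (continuousD (hf x) (hg x)).
- exact: (continuousM (hf x) (hg x)).
Qed.

(** On the line through any point y and a point x0 of A, the restriction of f has
    infinitely many zeros close to x0. *)
Lemma polynomial_eq0 f (A : set 'rV[R]_d) : is_polynomial f -> open A ->
  A !=set0 -> (forall x, A x -> f x = 0) -> f = fun=> 0.
Proof.
move=> pf oA [x0 Ax0] f0; apply/funext => y.
have [q hq] := polynomial_line pf x0 (y - x0).
suff q0 : q = 0 by have := hq 1; rewrite scale1r addrC subrK q0 horner0.
have /nbhs_ballP[e/= e0 eA] : nbhs x0 A by exact: open_nbhs_nbhs.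
(* more zeros than the degree allows; division by N keeps them in the ball,
   and N is positive also for y = x0 *)
pose N := 1 + `|y - x0|.
have N0 : 0 < N by rewrite /N; apply: ltr_pwDl.
pose s := [seq e / N / (k.+2)%:R | k <- iota 0 (size q)].
apply: (@roots_geq_poly_eq0 _ _ s).
- apply/allP => _ /mapP[k _ ->]; rewrite rootE -hq; apply/eqP/f0/eA.
  rewrite mx_norm_ball /ball_/= opprD addrA subrr sub0r normrN normrZ.
  rewrite gtr0_norm; last by rewrite !divr_gt0.
  rewrite (_ : _ * `|_| = e * (k.+2%:R^-1 * (`|y - x0| / N))); last by ring.
  rewrite -[ltRHS]mulr1 ltr_pM2l//.
  apply: (@le_lt_trans _ _ (k.+2%:R^-1 * 1)).
    rewrite ler_wpM2l ?invr_ge0// ler_pdivrMr// mul1r.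
    by rewrite /N lerDr.
  by rewrite mulr1 invf_lt1// ltr1n.
- rewrite map_inj_uniq ?iota_uniq// => i j /(mulfI _).
  rewrite mulf_neq0 ?invr_eq0 ?gt_eqF// => /(_ isT)/invr_inj/eqP.
  by rewrite eqr_nat => /eqP[].
- by rewrite size_map size_iota.
Qed.

(** Such an f vanishes almost everywhere on A. The points of A where it does not
    form an open set, which would have positive measure unless it is empty. *)
Lemma polynomial_sqr_eq0 f (A : set 'rV[R]_d) : is_polynomial f -> open A ->
  A !=set0 -> measurable A -> bounded_set A ->
  \int[lebd]_(x in A) (f x * f x) = 0 -> f = fun=> 0.
Proof.
move=> pf oA A0 mA bA If; apply: (polynomial_eq0 pf oA A0).
have lf := locally_bounded_polynomial pf.
have iff := integrable_indicM mA bA (locally_boundedM lf lf).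
have iff' : lebd.-integrable A (EFin \o (fun x => f x * f x)).
  apply/(integrable_mkcond _ mA); apply: eq_integrable iff => // x _.
  by rewrite /patch /= indicE; case: ifPn => xA /=; rewrite ?mul1r ?mul0r.
have : (\int[lebd]_(x in A) `|(EFin \o (fun x => (f x * f x)%R)) x| = 0)%E.
  have -> : (\int[lebd]_(x in A) `|(EFin \o (fun x => (f x * f x)%R)) x| =
      \int[lebd]_(x in A) (EFin \o (fun x => (f x * f x)%R)) x)%E.
    by apply: eq_integral => x _; rewrite /= ger0_norm // -expr2 sqr_ge0.
  by rewrite -(fineK (integrable_fin_num mA iff')); congr EFin; exact: If.
move=> /(ae_eq_integral_abs _ mA (measurable_int _ iff'))[N [mN N0 sN]] x Ax.
apply: contrapT => /eqP fx0.
pose B := A `&` [set x | f x != 0].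
have oB : open B.
  apply: openI => //; rewrite (_ : [set _ | _] = f @^-1` [set x | x != 0])//.
  apply: open_comp; last exact: open_neq.
  by move=> z _; exact: continuous_polynomial.
have mB : measurable B.
  apply: measurableI => //; rewrite (_ : [set _ | _] = f @^-1` [set~ 0]); last first.
    by apply/seteqP; split => z /= /eqP.
  by rewrite -[X in measurable X]setTI; apply: lf.1 => //; exact: measurableC.
have : (0 < lebd B)%E by apply: lebesgue_open_gt0 => //; exists x.
rewrite lt_neqAle => /andP[/eqP + _]; apply; apply/esym/eqP.
rewrite eq_le measure_ge0 andbT -N0 le_measure ?inE//.
apply: subset_trans sN => z [Az fz0] /= /(_ Az)[] /eqP.
by rewrite mulf_eq0 orbb; exact/negP.
Qed.

End polynomials.

(** * Polytopes, flat faces and exceptional lines *)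

Section polytopes.
Variables (R : realType) (d : nat).
Local Notation lebd := (lebesgue_rV R d).
Implicit Types (e : flat_face R d) (u x y : 'rV[R]_d).

Lemma measurable_le_fun (f g : 'rV[R]_d -> R) : measurable_fun setT f ->
  measurable_fun setT g -> measurable [set x | f x <= g x].
Proof.
move=> mf mg; rewrite -[X in measurable X]setTI.
exact: measurable_fun_le.
Qed.

Lemma measurable_polytope (A : set 'rV[R]_d) : polytope A -> measurable A.
Proof.
move=> [m [P [hP ->]]]; apply: fin_bigcup_measurable => //= k _.
have [_ [l [a [b ->]]]] := hP k.
rewrite (_ : [set _ | _] = \bigcap_(j in [set: 'I_l]) [set x | dot (a j) x <= b j]); last first.
  by apply/seteqP; split => x h j; [move=> _; exact: h|exact: (h j I)].
apply: fin_bigcap_measurable => //= j _.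
by apply: measurable_le_fun; [exact: measurable_dot|exact: measurable_cst].
Qed.

Lemma bounded_polytope (A : set 'rV[R]_d) : polytope A -> bounded_set A.
Proof.
move=> [m [P [hP ->]]].
have hM k : exists M : R, forall x, P k x -> `|x| <= M.
  by have [/bounded_onP] := hP k.
have {}hM k := cid (hM k).
apply/bounded_onP; exists (\sum_k `|projT1 (hM k)|) => x [k _ Pkx].
apply: le_trans (projT2 (hM k) _ Pkx) _; apply: le_trans (ler_norm _) _.
by rewrite (bigD1 k)//= lerDl sumr_ge0.
Qed.

Lemma negligible_exists (I : finType) (F : I -> set 'rV[R]_d) :
  (forall i, lebd.-negligible (F i)) -> lebd.-negligible [set x | exists i, F i x].
Proof.
move=> hF.
pose G (k : nat) := oapp (fun j : 'I_#|I| => F (enum_val j)) set0 (insub k).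
apply: (@negligibleS _ _ _ _ (\bigcup_k G k)).
  move=> x [i Fix]; exists (enum_rank i) => //.
  by rewrite /G valK /= enum_rankK.
apply: negligible_bigcup => k; rewrite /G; case: insubP => //= _.
exact: negligible_set0.
Qed.

Lemma negligible_hyperplane (n : 'rV[R]_d) (c : R) : n != 0 ->
  lebd.-negligible [set x | dot n x = c].
Proof.
move=> n0; exists [set x | dot n x = c]; split => //; last exact: hyperplane_null.
rewrite (_ : [set _ | _] = (fun x => dot n x) @^-1` [set c])//.
by rewrite -[X in measurable X]setTI; apply: measurable_dot.
Qed.

Lemma is_polynomial_dot (a : 'rV[R]_d) : is_polynomial (fun z => dot a z).
Proof.
exists (\sum_i (mpoly.mpolyC _ (a ord0 i) * mpoly.mpolyX R (mpoly.mnm1 i))).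
apply/funext => z; rewrite rmorph_sum; apply: eq_bigr => i _ /=.
by rewrite mpoly.mevalM mpoly.mevalC mpoly.mevalXU.
Qed.

Lemma continuous_dot (a : 'rV[R]_d) : continuous (fun z => dot a z).
Proof. exact/continuous_polynomial/is_polynomial_dot. Qed.

(** The projection on the hyperplane of e parallel to u, written as a slide in
    order to inherit measurability and bounds. *)
Definition oblique_foot e u : 'rV[R]_d -> 'rV[R]_d :=
  slide (face_normal e) (- (dot (face_normal e) u)^-1 *: u) (face_offset e).

Lemma oblique_footE e u x :
  oblique_foot e u x = x - (height e x / dot (face_normal e) u) *: u.
Proof. by rewrite /oblique_foot /slide scalerA mulrN scaleNr. Qed.

Lemma height_line e u x t :
  height e (x + t *: u) = height e x + t * dot (face_normal e) u.
Proof. by rewrite /height dotDr dotZr addrAC. Qed.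

Lemma oblique_foot_line e u x t : dot (face_normal e) u != 0 ->
  oblique_foot e u (x + t *: u) = oblique_foot e u x.
Proof.
move=> nu; rewrite !oblique_footE height_line mulrDl mulfK//.
by apply/rowP => i; rewrite !mxE; ring.
Qed.

Lemma oblique_foot_id e u x : height e x = 0 -> oblique_foot e u x = x.
Proof. by move=> h; rewrite oblique_footE h mul0r scale0r subr0. Qed.

Section face.
Variables (e : flat_face R d) (He : is_flat_face e).
Let n := face_normal e.
Let nn : dot n n = 1. Proof. by case: He. Qed.
Let n_neq0 : n != 0.
Proof.
apply/eqP => n0; move: nn; rewrite n0 /dot big1 => [/eqP|i _]; last by rewrite mxE mul0r.
by rewrite eq_sym oner_eq0.
Qed.

(** Otherwise all inequalities of some P k that contains y would be strict at y or
    constant on the hyperplane of e, and hold near y in this hyperplane. The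
    vector a k j - dot (a k j) n *: n is the tangential part of the gradient
    a k j. *)
Lemma relint_nonstrict (m : nat) (P : 'I_m -> set 'rV[R]_d) (l : 'I_m -> nat)
    (a : forall k, 'I_(l k) -> 'rV[R]_d) (b : forall k, 'I_(l k) -> R) y :
  face_set e = \bigcup_k P k ->
  (forall k, P k = [set x | forall j, dot (a k j) x <= b k j]) ->
  face_set e y -> ~ relint e y ->
  exists k, exists j, dot (a k j) y = b k j /\ a k j - dot (a k j) n *: n != 0.
Proof.
move=> eP PE ey nry; apply: contrapT => H; apply: nry; split=> //.
have hy : height e y = 0 by case: He => _ + _ _ _; apply.
have [k _ Pky] : (\bigcup_k P k) y by rewrite -eP.
have : \forall z \near y, forall j, dot (a k j) y < b k j -> dot (a k j) z < b k j.
  apply: (@filter_forall _ _ (fun j z =>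
    dot (a k j) y < b k j -> dot (a k j) z < b k j) (nbhs y) (nbhs_filter y)) => j.
  case: (ltP (dot (a k j) y) (b k j)) => [lt|_]; last exact: filterE.
  have h := cvgr_lt _ (@continuous_dot (a k j) y) _ lt.
  by apply: (@filterS _ (nbhs y) (nbhs_filter y) _ _ _ (h (nbhs_filter y))) => z hz _; exact: hz.
apply: (@filterS _ (nbhs y) (nbhs_filter y)) => z hz hz0; rewrite eP; exists k => //; rewrite PE => j.
have ay : dot (a k j) y <= b k j by move: Pky; rewrite PE; exact.
have [aE|lt] := eqVneq (dot (a k j) y) (b k j); last first.
  by apply/ltW/hz; rewrite lt_neqAle lt.
have [a0|a0] := eqVneq (a k j - dot (a k j) n *: n) 0; last first.
  by exfalso; apply: H; exists k, j.
move/eqP: a0; rewrite subr_eq0 => /eqP a0; rewrite -aE a0 !dotZl.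
have : dot n z = dot n y by apply: (addIr (- face_offset e)); rewrite -!/(height e _) hz0 hy.
by move=> ->.
Qed.

(** The set is covered by hyperplanes, one for each inequality of the face that
    is not constant on the hyperplane of the face: such an inequality, precomposed
    with the projection parallel to u, is not constant on the space either. *)
Lemma negligible_nonrelint u : dot n u != 0 ->
  lebd.-negligible [set x | face_set e (oblique_foot e u x) /\
    ~ relint e (oblique_foot e u x)].
Proof.
move=> nu; have [_ _ [m [P [hP eP]]] _ _] := He.
have hP' k : exists lab : {l : nat & (('I_l -> 'rV[R]_d) * ('I_l -> R))%type},
    P k = [set x | forall j, dot ((projT2 lab).1 j) x <= (projT2 lab).2 j].
  by have [_ [l [a [b Pk]]]] := hP k; exists (existT _ l (a, b)).
have {}hP' k := cid (hP' k).
pose l k := projT1 (projT1 (hP' k)).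
pose a k : 'I_(l k) -> 'rV[R]_d := (projT2 (projT1 (hP' k))).1.
pose b k : 'I_(l k) -> R := (projT2 (projT1 (hP' k))).2.
have PE k : P k = [set x | forall j, dot (a k j) x <= b k j].
  by rewrite (projT2 (hP' k)).
pose B k (j : 'I_(l k)) := [set x | dot (a k j) (oblique_foot e u x) = b k j /\
   a k j - dot (a k j) n *: n != 0].
apply: (@negligibleS _ _ _ _ [set x | exists k, exists j, B k j x]).
  move=> x [h1 h2]; have [k [j h]] := relint_nonstrict eP PE h1 h2.
  by exists k, j.
apply: negligible_exists => k; apply: negligible_exists => j; rewrite /B.
set v := a k j; set c := b k j.
have [v0|v0] := eqVneq (v - dot v n *: n) 0.
  by apply: (@negligibleS _ _ _ _ set0) => [x []//|]; exact: negligible_set0.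
have vu : v - (dot v u / dot n u) *: n != 0.
  apply: contra v0 => /eqP/subr0_eq vE; rewrite subr_eq0; apply/eqP.
  by rewrite {1}vE {2}vE dotZl nn mulr1.
apply: negligibleS (negligible_hyperplane (c - face_offset e * (dot v u / dot n u)) vu).
move=> x [+ _]; rewrite oblique_footE dotBr dotZr /height => <-.
rewrite /= dotDl dotNl dotZl -/n; ring.
Qed.

(** A line parallel to the hyperplane of the face that meets the face is
    contained in this hyperplane. *)
Lemma negligible_parallel u : dot n u = 0 ->
  lebd.-negligible [set x | exists t, face_set e (x + t *: u)].
Proof.
move=> nu; apply: negligibleS (negligible_hyperplane (face_offset e) n_neq0).
move=> x [t ext]; have [_ /(_ _ ext) + _ _ _] := He.
by rewrite height_line nu mulr0 addr0 => /subr0_eq.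
Qed.

End face.

Definition flip e := FlatFace (face_set e) (- face_normal e) (- face_offset e).

Lemma height_flip e x : height (flip e) x = - height e x.
Proof. by rewrite /height /= dotNl opprB opprK addrC. Qed.

Lemma relint_flip e : relint (flip e) = relint e.
Proof.
have hE y : height (flip e) y = 0 <-> height e y = 0.
  by rewrite height_flip; split=> [/eqP|->]; rewrite ?oppr0// oppr_eq0 => /eqP.
by apply/seteqP; split => x [ex h]; split => //; apply: filterS h => y /= h /hE; exact: h.
Qed.

Lemma is_flat_face_flip e : is_flat_face e -> is_flat_face (flip e).
Proof.
move=> [h1 h2 h3 h4 h5]; split => //=.
- by rewrite dotNl dotC dotNl opprK.
- by move=> x /h2; rewrite height_flip => ->; rewrite oppr0.
- by rewrite relint_flip.
Qed.

End polytopes.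

(** * Integrals over segments *)

Section unit_segment.
Variable R : realType.
Local Notation leb := (@lebesgue_measure R).
Implicit Types (q : {poly R}) (a b t : R).

Lemma integrable_horner q a b :
  leb.-integrable `[a, b]%classic (EFin \o (fun t => q.[t])).
Proof.
apply: continuous_compact_integrable; first exact: segment_compact.
apply: continuous_subspaceT => t; exact: continuous_horner.
Qed.

Lemma Rintegral_deriv_poly q a b : a <= b ->
  \int[leb]_(t in `[a, b]) q^`().[t] = q.[b] - q.[a].
Proof.
rewrite le_eqVlt => /orP[/eqP ->|ab].
  by rewrite set_itv1 Rintegral_set1 subrr.
rewrite /Rintegral (@continuous_FTC2 _ (fun t => q^`().[t]) (horner q))//.
- by apply: continuous_subspaceT => t; exact: continuous_horner.
- split.
  + by move=> t _; exact: derivable_horner.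
  + by apply: cvg_at_right_filter; exact: continuous_horner.
  + by apply: cvg_at_left_filter; exact: continuous_horner.
- by move=> t _; rewrite derivE.
Qed.

(** The fundamental theorem of calculus for a polynomial that is cut off at the
    zero - h / nu of an affine function. The formula is the same for both signs
    of the slope; if there is no change of sign between 0 and 1 then the last
    term vanishes, wherever the zero lies. *)
Lemma Rintegral_step q (h nu : R) : nu != 0 ->
  \int[leb]_(t in `[0, 1]) ((0 <= h + t * nu)%R%:R * q^`().[t]) =
  (0 <= h + nu)%R%:R * q.[1] - (0 <= h)%R%:R * q.[0]
    - ((0 <= h + nu)%R%:R - (0 <= h)%R%:R) * q.[- h / nu].
Proof.
move=> nu0; set A := [set t : measurableTypeR R | 0 <= h + t * nu].
have -> : \int[leb]_(t in `[0, 1]) ((0 <= h + t * nu)%R%:R * q^`().[t]) =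
    \int[leb]_(t in `[0, 1] `&` A) q^`().[t].
  rewrite Rintegral_mkcondr; apply: eq_Rintegral => t _.
  rewrite /patch; have [hA|hA] := boolP (0 <= h + t * nu).
    by rewrite mem_set// mul1r.
  by rewrite memNset ?mul0r//=; exact/negP.
have full a b : (forall t, 0 <= t <= 1 -> (0 <= h + t * nu) = (a <= t <= b)) ->
    0 <= a -> b <= 1 -> a <= b ->
    \int[leb]_(t in `[0, 1] `&` A) q^`().[t] = q.[b] - q.[a].
  move=> hab a0 b1 ab; rewrite -Rintegral_deriv_poly//; congr Rintegral.
  apply/seteqP; split => t /=; rewrite !in_itv/=.
    by move=> [t01]; rewrite /A /= hab.
  move=> /andP[at_ tb]; have t01 : 0 <= t <= 1.
    by rewrite (le_trans a0 at_) (le_trans tb b1).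
  by split => //; rewrite /A /= hab// at_ tb.
have none : (forall t, 0 <= t <= 1 -> (0 <= h + t * nu) = false) ->
    \int[leb]_(t in `[0, 1] `&` A) q^`().[t] = 0.
  move=> hab; rewrite (_ : _ `&` _ = set0) ?Rintegral_set0//.
  by apply/seteqP; split => // t [/=]; rewrite in_itv/= /A /= => /hab ->.
have [nu_gt0|nu_lt0] : 0 < nu \/ nu < 0.
  by move: nu0; rewrite neq_lt => /orP[]; [right|left].
- have tE t : (0 <= h + t * nu) = (- h / nu <= t).
    by rewrite ler_pdivrMr//; apply/idP/idP => ?; lra.
  have [h0|h0] := leP 0 h.
    have hn : 0 <= h + nu by lra.
    rewrite hn (full 0 1)//; first by rewrite !mul1r subrr mul0r subr0.
    move=> t t01; rewrite t01 addr_ge0// mulr_ge0//; lra.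
  have [hn|hn] := leP 0 (h + nu).
    rewrite (full (- h / nu) 1)//; first by rewrite !mul1r mul0r !subr0 mul1r.
    + by move=> t /andP[_ t1]; rewrite tE t1 andbT.
    + by rewrite divr_ge0//; lra.
    + by rewrite ler_pdivrMr//; lra.
  rewrite none; first by rewrite subrr !mul0r !subr0.
  move=> t /andP[t0 t1]; apply/negbTE; rewrite -ltNge; nra.
- have tE t : (0 <= h + t * nu) = (t <= - h / nu).
    by rewrite ler_ndivlMr//; apply/idP/idP => ?; lra.
  have [hn|hn] := leP 0 (h + nu).
    have h0 : 0 <= h by lra.
    rewrite h0 (full 0 1)//; first by rewrite !mul1r subrr mul0r subr0.
    move=> t /andP[t0 t1]; rewrite t0 t1; nra.
  have [h0|h0] := leP 0 h.
    rewrite (full 0 (- h / nu))//.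
    + by rewrite !mul1r mul0r !sub0r mulN1r opprK addrC.
    + by move=> t /andP[t0 _]; rewrite tE t0.
    + by rewrite ler_ndivrMr//; lra.
    + by rewrite ler_ndivlMr//; lra.
  rewrite none; first by rewrite subrr !mul0r !subr0.
  move=> t /andP[t0 t1]; apply/negbTE; rewrite -ltNge; nra.
Qed.

Lemma integrable_step q (h nu : R) :
  leb.-integrable `[0, 1]%classic
    (EFin \o (fun t => (0 <= h + t * nu)%R%:R * q.[t])).
Proof.
have iq := integrable_horner q 0 1.
have mI : measurable (`[0, 1]%classic : set (measurableTypeR R)) by exact: measurable_itv.
have /measurable_EFinP mq := measurable_int _ iq.
apply: (le_integrable mI _ _ iq).
- apply/measurable_EFinP; apply: measurable_funM => //; apply: measurable_funTS.
  rewrite (_ : (fun t => _) = \1_[set t : measurableTypeR R | 0 <= h + nu * t]); last first.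
    apply/funext => t; rewrite indicE; case: (boolP (0 <= h + t * nu)) => ht.
      by rewrite mem_set//= [nu * t]mulrC.
    by rewrite memNset//=; rewrite [nu * t]mulrC; exact/negP.
  apply: measurable_indic; rewrite -[X in measurable X]setTI.
  by apply: measurable_fun_le => //; exact: measurable_affine.
- move=> t _ /=; rewrite lee_fin normrM; case: (0 <= _); rewrite ?normr1 ?mul1r//.
  by rewrite normr0 mul0r.
Qed.

End unit_segment.

Section averaging.
Variables (R : realType) (d : nat).
Local Notation leb := (@lebesgue_measure R).
Local Notation lebd := (lebesgue_rV R d).
Local Notation I01 := (`[0%R, 1%R]%classic : set (measurableTypeR R)).
Local Open Scope ereal_scope.

Lemma integrable_segments (u : 'rV[R]_d) (g : 'rV[R]_d -> R) :
  lebd.-integrable setT (EFin \o g) ->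
  (lebd \x leb).-integrable setT
    (fun p : 'rV[R]_d * measurableTypeR R => (\1_I01 p.2 * g (p.1 + p.2 *: u)%R)%:E).
Proof.
move=> ig; have /measurable_EFinP mg := measurable_int _ ig.
have m1 : measurable_fun setT (fun p : 'rV[R]_d * measurableTypeR R => \1_I01 p.2 : R).
  by apply: measurableT_comp; [exact: measurable_indic|exact: measurable_snd].
have mP : measurable_fun setT (fun p : 'rV[R]_d * measurableTypeR R =>
    (\1_I01 p.2 * g (p.1 + p.2 *: u)%R)%:E).
  apply/measurable_EFinP; apply: measurable_funM => //.
  by apply: (measurableT_comp mg); exact: measurable_line.
apply/(integrable21ltyP lebd leb mP).
have mag : measurable_fun setT (fun x => `|(g x)%:E|).
  by apply: measurableT_comp; [exact: abse_measurable|exact/measurable_EFinP].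
rewrite (eq_integral (fun t : measurableTypeR R => (\1_I01 t)%:E * \int[lebd]_x `|(g x)%:E|)); last first.
  move=> t _ /=.
  rewrite -(@ge0_integral_translate _ _ (t *: u)%R (fun x => `|(g x)%:E|))//.
  rewrite -ge0_integralZl//; last first.
    by apply: (measurableT_comp mag); exact: measurable_addr_rV.
  by apply: eq_integral => x _; rewrite normrM EFinM ger0_norm.
rewrite ge0_integralZr//; last 2 first.
- exact/measurable_EFinP/measurable_indic.
- exact: integral_ge0.
rewrite integral_indic// setIT /= lebesgue_measure_itv/= lte_fin ltr01 -EFinD subr0 mul1e.
by have /integrableP[] := ig.
Qed.

(** For each t the integral over x does not see the translation by t u. *)
Lemma integral_average (u : 'rV[R]_d) (g : 'rV[R]_d -> R) :
  lebd.-integrable setT (EFin \o g) ->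
  \int[lebd]_x (g x)%:E =
  \int[lebd]_x \int[leb]_t (\1_I01 t * g (x + t *: u)%R)%:E.
Proof.
move=> ig; have iP := integrable_segments u ig.
rewrite (Fubini iP) /=.
rewrite (eq_integral (fun t : measurableTypeR R => (\1_I01 t)%:E * \int[lebd]_x (g x)%:E)); last first.
  move=> t _.
  have [it ht] := Rintegral_translate (t *: u) ig.
  have -> : \int[lebd]_x (g x)%:E = \int[lebd]_x (g (x + t *: u)%R)%:E.
    rewrite -[LHS]fineK; last exact: (integrable_fin_num measurableT ig).
    rewrite -[RHS]fineK; last exact: (integrable_fin_num measurableT it).
    by congr EFin.
  by rewrite -integralZl//=; apply: eq_integral => x _.
have Cfin := integrable_fin_num measurableT ig.
rewrite -(fineK Cfin).
under [RHS]eq_integral do rewrite -EFinM mulrC.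
have := @integralZl _ _ _ leb setT measurableT (fun t : measurableTypeR R => (\1_I01 t)%:E) _
   (fine (\int[lebd]_x (g x)%:E)).
rewrite integral_indic// setIT /= lebesgue_measure_itv/= lte_fin ltr01 -EFinD subr0 mule1.
by move=> <-//; exact: integrable_indic_itv.
Qed.

End averaging.

(** * Face integrals over oblique prisms *)

Section face_integrals.
Variables (R : realType) (d : nat).
Local Notation lebd := (lebesgue_rV R d).
Implicit Types (e : flat_face R d) (u x y : 'rV[R]_d) (f : 'rV[R]_d -> R).

Lemma eq_indic (T U : Type) (A : set T) (B : set U) (x : T) (y : U) : (A x <-> B y) ->
  \1_A x = \1_B y :> R.
Proof.
by move=> AB; rewrite !indicE; congr (nat_of_bool _)%:R; apply/idP/idP => /set_mem/AB h; exact/mem_set.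
Qed.

Lemma eq_integral_ae (f g : 'rV[R]_d -> \bar R) :
  measurable_fun setT f -> measurable_fun setT g ->
  lebd.-negligible [set x | f x <> g x] ->
  (\int[lebd]_x f x = \int[lebd]_x g x)%E.
Proof.
move=> mf mg nfg; apply: ae_eq_integral => //.
apply: negligibleS nfg => x /= h fg; apply: h => _; exact: fg.
Qed.

Lemma locally_bounded_height e : locally_bounded (height e).
Proof.
apply: locally_boundedB; last exact: locally_bounded_cst.
exact/locally_bounded_polynomial/is_polynomial_dot.
Qed.

Lemma locally_bounded_ge0 (g : 'rV[R]_d -> R) : measurable_fun setT g ->
  locally_bounded (fun x => (0 <= g x)%R%:R : R).
Proof.
move=> mg; rewrite (_ : (fun x => _) = \1_[set x | 0 <= g x]); last first.
  apply/funext => x; rewrite indicE; case: (boolP (0 <= g x)) => h.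
    by rewrite mem_set.
  by rewrite memNset//=; exact/negP.
apply: locally_bounded_indic; apply: measurable_le_fun => //; exact: measurable_cst.
Qed.

(** The heights are measured along the normal, whatever u is. *)
Definition prism e u (a b : R) : set 'rV[R]_d :=
  [set x | a <= height e x <= b /\ face_set e (oblique_foot e u x)].

Lemma measurable_prism e u a b : polytope (face_set e) -> measurable (prism e u a b).
Proof.
move=> pe; rewrite (_ : prism e u a b = [set x | a <= height e x] `&`
    ([set x | height e x <= b] `&` (oblique_foot e u @^-1` face_set e))).
  have mh := (locally_bounded_height e).1.
  apply: measurableI; first by apply: measurable_le_fun => //; exact: measurable_cst.
  apply: measurableI; first by apply: measurable_le_fun => //; exact: measurable_cst.
  rewrite -[X in measurable X]setTI; apply: measurable_slide => //.
  exact: measurable_polytope.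
by apply/seteqP; split => x [] => [/andP[]|h1 []]; rewrite /prism /=; [|rewrite h1 => ->].
Qed.

Lemma bounded_prism e u a b : polytope (face_set e) -> bounded_set (prism e u a b).
Proof.
move=> /bounded_polytope/bounded_onP[M hM]; apply/bounded_onP.
exists (M + (`|a| + `|b|) * `|(dot (face_normal e) u)^-1| * `|u|) => x [/andP[ha hb] fx].
have xE : x = oblique_foot e u x + (height e x / dot (face_normal e) u) *: u.
  by rewrite oblique_footE subrK.
rewrite xE; apply: le_trans (ler_normD _ _) _; apply: lerD; first exact: hM.
rewrite normrZ normrM ler_wpM2r// ler_wpM2r// ler_norml.
have := ler_norm a; have := ler_norm b; have := ler_norm (- a); have := normr_ge0 b.
have := normr_ge0 a; rewrite normrN => *; apply/andP; split; lra.
Qed.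

Lemma prism_integrable e u a b f : polytope (face_set e) -> locally_bounded f ->
  lebd.-integrable setT (EFin \o (fun x => \1_(prism e u a b) x * f x)).
Proof.
by move=> pe bf; apply: integrable_indicM => //; [exact: measurable_prism|exact: bounded_prism].
Qed.

Lemma oblique_foot_normal e x : is_flat_face e ->
  oblique_foot e (face_normal e) x = x - height e x *: face_normal e.
Proof. by move=> [nn _ _ _ _]; rewrite oblique_footE nn divr1. Qed.

Lemma face_integralE e f : is_flat_face e ->
  face_integral e f =
  \int[lebd]_x (\1_(prism e (face_normal e) 0 1) x * f (oblique_foot e (face_normal e) x)).
Proof.
move=> fe; rewrite -Rintegral_indic /face_integral.
have -> : [set x | 0 <= height e x <= 1 /\ face_set e (x - height e x *: face_normal e)] =
    prism e (face_normal e) 0 1.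
  by apply/seteqP; split => x [h1]; rewrite /prism /= oblique_foot_normal.
by apply: eq_Rintegral => x _; rewrite oblique_foot_normal.
Qed.

Lemma locally_bounded_foot e u f : locally_bounded f ->
  locally_bounded (fun x => f (oblique_foot e u x)).
Proof. exact: locally_bounded_slide. Qed.

(** Translation by the normal exchanges the prisms on the two sides of the face. *)
Lemma face_integral_below e f : is_flat_face e -> locally_bounded f ->
  face_integral e f =
  \int[lebd]_x (\1_(prism e (face_normal e) (-1) 0) x * f (oblique_foot e (face_normal e) x)).
Proof.
move=> fe bf; have [nn _ pe _ _] := fe; rewrite face_integralE//.
have nn0 : dot (face_normal e) (face_normal e) != 0 by rewrite nn oner_eq0.
have bf' := locally_bounded_foot e (face_normal e) bf.
have [_ <-] := Rintegral_translate (face_normal e) (prism_integrable (face_normal e) 0 1 pe bf').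
apply: eq_Rintegral => x _.
have E : oblique_foot e (face_normal e) (x + face_normal e) = oblique_foot e (face_normal e) x.
  by have := oblique_foot_line x 1 nn0; rewrite scale1r.
rewrite E; congr (_ * _); apply: eq_indic.
have hE : height e (x + face_normal e) = height e x + 1.
  by rewrite -[X in height e (x + X)]scale1r height_line nn mulr1.
rewrite /prism /= E hE; split => -[/andP[h1 h2] h3]; split => //.
- by apply/andP; split; lra.
- by apply/andP; split; lra.
Qed.

Lemma face_integral_flip e f : is_flat_face e -> locally_bounded f ->
  face_integral (flip e) f = face_integral e f.
Proof.
move=> fe bf; have ffe := is_flat_face_flip fe.
rewrite (face_integral_below fe bf) (face_integralE _ ffe).
apply: eq_Rintegral => x _.
rewrite !oblique_foot_normal//= height_flip scalerN scaleNr opprK.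
congr (_ * _); apply: eq_indic; rewrite /prism /= height_flip.
rewrite (oblique_foot_normal _ ffe) (oblique_foot_normal _ fe) /= height_flip scalerN scaleNr opprK.
by split => -[/andP[h1 h2] h3]; split => //; apply/andP; split; lra.
Qed.

(** The flux of f u through e, computed in two ways. The integrand counts, with
    the sign of dot n u, the points x such that the segment from x to x + u
    crosses e. They fill an oblique prism with base e, which the slide L makes
    upright. *)
Lemma face_integral_oblique e u f : is_flat_face e -> locally_bounded f ->
  dot (face_normal e) u != 0 ->
  let cross x := \1_(face_set e) (oblique_foot e u x) *
    ((0 <= height e (x + u))%R%:R - (0 <= height e x)%R%:R) * f (oblique_foot e u x) in
  lebd.-integrable setT (EFin \o cross) /\
  \int[lebd]_x cross x = dot (face_normal e) u * face_integral e f.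
Proof.
move=> fe bf; set n := face_normal e; set nu := dot n u => nu0 cross.
have [nn _ pe _ _] := fe; rewrite -/n in nn.
have nn0 : dot n n != 0 by rewrite nn oner_eq0.
(* the signed crossing indicator as a function of the height after L *)
pose sigma x : R := (0 <= nu * (height e x + 1))%R%:R - (0 <= nu * height e x)%R%:R.
pose g x := \1_(prism e n (-1) 0) x * (sigma x * f (oblique_foot e n x)).
have mh := (locally_bounded_height e).1.
have bsigma : locally_bounded sigma.
  apply: locally_boundedB; apply: locally_bounded_ge0; apply: measurable_funM => //.
  exact: measurable_funD.
have bf' := locally_bounded_foot e n bf.
have ig : lebd.-integrable setT (EFin \o g).
  by apply: prism_integrable => //; exact: locally_boundedM.
(* L fixes the hyperplane of e and maps u to n *)
pose w := nu^-1 *: (n - u).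
have rhoE : 1 + dot n w = nu^-1.
  by rewrite /w dotZr dotBr nn -/nu; field.
have rho0 : 1 + dot n w != 0 by rewrite rhoE invr_eq0.
have [igL IgL] := Rintegral_slide (face_offset e) rho0 ig.
pose L := slide n w (face_offset e).
have LE x : L x = x + (height e x / nu) *: n - (height e x / nu) *: u.
  by rewrite /L /slide -/(height e x) /w; apply/rowP => i; rewrite !mxE; ring.
have hL x : height e (L x) = height e x / nu.
  by rewrite LE -scaleNr !height_line -/n -/nu nn; field.
have footL x : oblique_foot e n (L x) = oblique_foot e u x.
  rewrite oblique_foot_normal// hL oblique_footE LE -/n -/nu.
  by apply/rowP => i; rewrite !mxE; ring.
have sigmaL x : sigma (L x) = (0 <= height e (x + u))%R%:R - (0 <= height e x)%R%:R.
  rewrite /sigma hL -[u]scale1r height_line -/n -/nu mul1r mulrDr mulr1.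
  by rewrite [nu * (_ / _)]mulrC divfK.
have sigma_out x : ~~ (-1 <= height e x <= 0) -> sigma x = 0.
  rewrite negb_and -!ltNge => out.
  suff sE : (0 <= nu * (height e x + 1)) = (0 <= nu * height e x) by rewrite /sigma sE subrr.
  have [nu_gt0|nu_lt0] : 0 < nu \/ nu < 0.
    by move: nu0; rewrite neq_lt => /orP[]; [right|left].
  - by rewrite !pmulr_rge0//; apply/idP/idP => h; case/orP: out => h'; lra.
  - by rewrite !nmulr_rge0//; apply/idP/idP => h; case/orP: out => h'; lra.
have gL x : g (L x) = cross x.
  rewrite /g /cross footL sigmaL -mulrA.
  have [hin|hout] := boolP (-1 <= height e (L x) <= 0).
    congr (_ * _); apply: eq_indic; rewrite /prism /= footL.
    by split => [[]|].
  by rewrite -(sigmaL x) sigma_out// !mul0r !mulr0.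
have -> : cross = (fun x => g (L x)) by apply/funext => x; rewrite gL.
split; first exact: igL.
(* sigma is the sign of nu between the two bases of the prism below e, and the
   bases are null sets *)
have -> : face_integral e f = Num.sg nu * \int[lebd]_x g x.
  rewrite (face_integral_below fe bf) -/n.
  rewrite -(RintegralZl _ measurableT ig).
  congr fine; apply: eq_integral_ae.
  - exact: (measurable_int _ (prism_integrable n (-1) 0 pe bf')).
  - apply/measurable_EFinP; apply: measurable_funM => //.
    by apply/measurable_EFinP; exact: (measurable_int _ ig).
  have n0 : n != 0 by apply/eqP => n0; move: nn0; rewrite n0 /dot big1 ?eqxx// => i _; rewrite mxE mul0r.
  apply: negligibleS (negligibleU
    (negligible_hyperplane (face_offset e) n0) (negligible_hyperplane (face_offset e - 1) n0)).
  move=> x /= H; apply: contrapT => /not_orP[h0 h1]; apply: H; congr EFin.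
  rewrite /g; have [hin|hout] := boolP (-1 <= height e x <= 0); last first.
    rewrite indicE memNset ?mul0r ?mulr0//= => -[hin _].
    by rewrite hin in hout.
  have hh0 : height e x != 0 by apply/eqP => /subr0_eq.
  have hh1 : height e x != - 1.
    by apply/eqP; rewrite /height => h; apply: h1; rewrite -h; ring.
  have {hin} [hlo hhi] : -1 < height e x /\ height e x < 0.
    by move: hin => /andP[? ?]; rewrite !lt_neqAle hh0 eq_sym hh1; split.
  have -> : sigma x = Num.sg nu.
    rewrite /sigma; have [nu_gt0|nu_lt0] : 0 < nu \/ nu < 0.
      by move: nu0; rewrite neq_lt => /orP[]; [right|left].
    - by rewrite !pmulr_rge0// gtr0_sg// [0 <= height e x]leNgt hhi (_ : 0 <= _)%R ?subr0//; lra.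
    - rewrite !nmulr_rge0// ltr0_sg// (ltW hhi) leNgt (_ : 0 < _)%R ?sub0r//; lra.
  by rewrite mulrCA; congr (_ * _); rewrite mulrA -expr2 sqr_sg nu0 mul1r.
rewrite IgL rhoE normfV -/L mulrA [nu * _]mulrC -normrEsg mulrA mulfV ?mul1r//.
by rewrite normr_eq0.
Qed.

End face_integrals.

(** * The divergence theorem on a polytope *)

Section divergence_theorem.
Variables (R : realType) (d : nat) (K : set 'rV[R]_d) (E : finType) (P : pred E).
Variable F : E -> flat_face R d.
Hypothesis K_open : open K.
Hypothesis K_measurable : measurable K.
Hypothesis K_bounded : bounded_set K.
Hypothesis K_boundary : boundary K = [set x | exists2 e, P e & face_set (F e) x].
Hypothesis F_flat : forall e, P e -> is_flat_face (F e).
Hypothesis F_normal : forall e x, P e -> relint (F e) x ->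
  outward_unit_normal K x (face_normal (F e)).
Hypothesis F_disjoint : forall e e', P e -> P e' -> e != e' ->
  relint (F e) `&` relint (F e') = set0.

Definition transversal (u : 'rV[R]_d) (e : E) := dot (face_normal (F e)) u != 0.

(** The lines along which the crossings of the boundary are simple; almost all
    lines parallel to u are such. *)
Definition generic_line (u x : 'rV[R]_d) := forall e, P e ->
  if transversal u e
  then face_set (F e) (oblique_foot (F e) u x) -> relint (F e) (oblique_foot (F e) u x)
  else forall t, ~ face_set (F e) (x + t *: u).

Lemma generic_line_ae u :
  (lebesgue_rV R d).-negligible [set x | ~ generic_line u x].
Proof.
pose B (e : E) := [set x | P e /\ ~ (if transversal u e
  then face_set (F e) (oblique_foot (F e) u x) -> relint (F e) (oblique_foot (F e) u x)
  else forall t, ~ face_set (F e) (x + t *: u))].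
apply: (@negligibleS _ _ _ _ [set x | exists e, B e x]).
  by move=> x /= /existsNP[e /not_implyP[h1 h2]]; exists e.
apply: negligible_exists => e; rewrite /B.
have [Pe|nPe] := boolP (P e); last first.
  by apply: (@negligibleS _ _ _ _ set0) => [x []//|]; exact: negligible_set0.
have [tr|/negPn/eqP tr] := boolP (transversal u e).
  apply: negligibleS (negligible_nonrelint (F_flat Pe) tr).
  by move=> x [_ /not_implyP].
apply: negligibleS (negligible_parallel (F_flat Pe) tr).
by move=> x [_ /existsNP[t /contrapT]]; exists t.
Qed.

Definition above (e : E) (x : 'rV[R]_d) : R := (0 <= height (F e) x)%R%:R.

Definition shadow (u : 'rV[R]_d) (e : E) (x : 'rV[R]_d) : R :=
  \1_(face_set (F e)) (oblique_foot (F e) u x).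

(** The key to the divergence theorem: when the line leaves K through a face,
    the indicator of K drops and the indicator of the outer side of that face
    jumps up, and conversely when it enters K. The sum is constant along a generic
    line, without any bookkeeping of the order and sign of the crossings. *)
Definition crossing u x (t : R) : R := \1_K (x + t *: u) +
  \sum_(e | P e && transversal u e) shadow u e x * above e (x + t *: u).

Lemma line_cvg (x u : 'rV[R]_d) (t0 : R) (Q : set 'rV[R]_d) :
  (\forall z \near x + t0 *: u, Q z) -> \forall t \near t0, Q (x + t *: u).
Proof.
have cl : (fun t : R => x + t *: u) t @[t --> t0] --> x + t0 *: u.
  by apply: cvgD; [exact: cvg_cst|apply: cvgZl; exact: cvg_id].
by move=> h; exact: (cl _ h).
Qed.

Lemma above_locally_cst e u x t0 : height (F e) (x + t0 *: u) != 0 ->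
  \forall t \near t0, above e (x + t *: u) = above e (x + t0 *: u).
Proof.
have ch : (fun t : R => height (F e) (x + t *: u)) t @[t --> t0] --> height (F e) (x + t0 *: u).
  rewrite (_ : (fun t => height (F e) (x + t *: u)) =
      fun t => height (F e) x + t * dot (face_normal (F e)) u); last first.
    by apply/funext => t; rewrite height_line.
  rewrite height_line.
  apply: (@cvgD _ _ R); [exact: cvg_cst|].
  by apply: cvgM; [exact: cvg_id|exact: cvg_cst].
rewrite neq_lt => /orP[h|h]; rewrite /above.
- have : \forall t \near t0, height (F e) (x + t *: u) < 0 by apply: (cvgr_lt _ ch).
  apply: filterS => t ht.
  by rewrite !leNgt ht h.
- have : \forall t \near t0, 0 < height (F e) (x + t *: u) by apply: (cvgr_gt _ ch).
  apply: filterS => t ht.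
  by rewrite !ltW.
Qed.

(** If the line crosses no face at the point y, then y is off the boundary and
    every term is locally constant. Otherwise it crosses exactly one face there,
    as the relative interiors are disjoint, and K is locally the inner side of
    this face. *)
Lemma crossing_locally_cst u x t0 : generic_line u x ->
  \forall t \near t0, crossing u x t = crossing u x t0.
Proof.
move=> gx; set y := x + t0 *: u.
have footE e : transversal u e -> height (F e) y = 0 -> oblique_foot (F e) u x = y.
  by move=> tr hy; rewrite -(@oblique_foot_line _ _ _ u x t0)// oblique_foot_id.
(* a face is active if the line crosses it at y *)
pose active e := [&& P e, transversal u e, height (F e) y == 0 &
  oblique_foot (F e) u x \in face_set (F e)].
have term_cst e : P e && transversal u e -> ~~ active e ->
    \forall t \near t0, shadow u e x * above e (x + t *: u) = shadow u e x * above e y.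
  move=> /andP[Pe tr]; rewrite /active Pe tr /= negb_and => /orP[hy|nf].
    by have := above_locally_cst hy; apply: filterS => t ->.
  by apply: filterE => t; rewrite /shadow indicE (negbTE nf) !mul0r.
have active_relint e : active e -> relint (F e) y.
  move=> /and4P[Pe tr /eqP hy /set_mem fe]; have := gx _ Pe; rewrite tr => /(_ fe).
  by rewrite (footE _ tr hy).
have [[e0 ae0]|noact] := pselect (exists e, active e).
- have [Pe0 tr0 /eqP hy0 /set_mem fe0] := and4P ae0.
  have others e : P e && transversal u e && (e != e0) -> ~~ active e.
    move=> /andP[/andP[Pe _] ee0]; apply/negP => ae.
    have : (relint (F e) `&` relint (F e0)) y by split; exact: active_relint.
    by rewrite F_disjoint.
  have [_ /line_cvg hK] := F_normal Pe0 (active_relint _ ae0).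
  have hy z : dot (face_normal (F e0)) (z - y) = height (F e0) z.
    by rewrite dotBr /height; move: hy0; rewrite /height => /subr0_eq ->.
  have rest : \forall t \near t0, forall e, P e && transversal u e && (e != e0) ->
      shadow u e x * above e (x + t *: u) = shadow u e x * above e y.
    apply: (@filter_forall _ _ (fun e t => P e && transversal u e && (e != e0) ->
      shadow u e x * above e (x + t *: u) = shadow u e x * above e y) (nbhs t0) (nbhs_filter t0)) => e.
    case: (boolP (P e && transversal u e && (e != e0))) => he; last exact: filterE.
    have := term_cst e (proj1 (andP he)) (others e he).
    by apply: filterS => t ->.
  have one z : (K z <-> dot (face_normal (F e0)) (z - y) < 0) ->
      \1_K z + shadow u e0 x * above e0 z = 1.
    rewrite hy /shadow /above !indicE (mem_set fe0)/= mul1r leNgt.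
    case: ltP => hz Kz; first by rewrite mem_set ?addr0//; exact/Kz.
    by rewrite memNset ?add0r// => /Kz.
  have hK0 := nbhs_singleton hK.
  apply: filterS2 hK rest => t hKt ht.
  rewrite /crossing (bigD1 e0) ?Pe0//= [in RHS](bigD1 e0) ?Pe0//= !addrA.
  rewrite (one _ hKt) (one _ hK0); congr (_ + _).
  by apply: eq_bigr => e he; exact: ht.
- have nact e : ~~ active e by apply/negP => ae; apply: noact; exists e.
  have rest : \forall t \near t0, forall e, P e && transversal u e ->
      shadow u e x * above e (x + t *: u) = shadow u e x * above e y.
    apply: (@filter_forall _ _ (fun e t => P e && transversal u e ->
      shadow u e x * above e (x + t *: u) = shadow u e x * above e y) (nbhs t0) (nbhs_filter t0)) => e.
    case: (boolP (P e && transversal u e)) => he; last exact: filterE.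
    by have := term_cst e he (nact e); apply: filterS => t ->.
  have nb : ~ boundary K y.
    rewrite K_boundary => -[e Pe fe].
    have [_ /(_ _ fe) hy _ _ _] := F_flat Pe.
    have := gx _ Pe; case: ifPn => [tr _|_]; last by move=> /(_ t0).
    have := nact e; rewrite /active Pe tr hy eqxx /= (footE _ tr hy) => /negP; apply.
    exact/mem_set.
  have hK : \forall t \near t0, \1_K (x + t *: u) = \1_K y :> R.
    have [Ky|nKy] := pselect (K y).
      have /line_cvg : \forall z \near y, K z by exact: open_nbhs_nbhs.
      by apply: filterS => t Kt; rewrite !indicE !mem_set.
    have ncK : ~ closure K y.
      move=> cK; apply: nb; split => //.
      by rewrite (interior_id K).1.
    have /line_cvg : \forall z \near y, ~ K z.
      have : nbhs y (~` closure K).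
        by apply: open_nbhs_nbhs; split => //; rewrite openC; exact: closed_closure.
      by apply: filterS => z ncz Kz; apply: ncz; exact: subset_closure.
    by apply: filterS => t Kt; rewrite !indicE !memNset.
  apply: filterS2 hK rest => t hKt ht.
  by rewrite /crossing hKt; congr (_ + _); apply: eq_bigr => e he; exact: ht.
Qed.

Lemma crossing_cst u x s t : generic_line u x -> crossing u x s = crossing u x t.
Proof.
move=> gx; apply: is_derive_0_is_cst => t0.
apply: (@near_eq_is_derive _ _ _ (cst (crossing u x t0))).
  by have := crossing_locally_cst t0 gx; apply: filterS => z ->.
Qed.

Variable u : 'rV[R]_d.
Local Notation lebd := (lebesgue_rV R d).
Local Notation leb := (@lebesgue_measure R).
Local Notation I01 := (`[0%R, 1%R]%classic : set (measurableTypeR R)).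
Local Notation trans e := (P e && transversal u e).

Let nu e := dot (face_normal (F e)) u.

(** The left-hand side is the integral of the derivative of f over the part of
    the segment in K. The indicator of K is a constant minus indicators of
    half-lines, so [Rintegral_step] applies to each term; the constant is
    eliminated by its values at the two ends of the segment. *)
Lemma segment_identity f x (q : {poly R}) : generic_line u x ->
  (forall t, f (x + t *: u) = q.[t]) ->
  (\int[leb]_t (\1_I01 t * (\1_K (x + t *: u) * q^`().[t])%R)%:E)%E =
  (\1_K (x + u) * f (x + u) - \1_K x * f x +
    \sum_(e | trans e) shadow u e x * (above e (x + u) - above e x) *
       f (oblique_foot (F e) u x))%:E.
Proof.
move=> gx fq.
have cross0 t : \1_K (x + t *: u) = crossing u x 0 -
    \sum_(e | trans e) shadow u e x * above e (x + t *: u).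
  rewrite (crossing_cst 0 t gx).
  by rewrite /crossing addrK.
pose G t : R := crossing u x 0 * q^`().[t] +
  - (\sum_(e | trans e) shadow u e x * ((0 <= height (F e) x + t * nu e)%R%:R * q^`().[t])).
have GE t : \1_K (x + t *: u) * q^`().[t] = G t.
  rewrite cross0 mulrBl /G mulr_suml; congr (_ - _); apply: eq_bigr => e _.
  by rewrite /above height_line mulrA.
have mI : measurable I01 by exact: measurable_itv.
have i1 := integrable_horner q^`() 0 1.
have i1' : leb.-integrable I01 (EFin \o (fun t => crossing u x 0 * q^`().[t])).
  exact: (integrableZl mI _ i1).
have i2 e : leb.-integrable I01 (EFin \o (fun t =>
    (0 <= height (F e) x + t * nu e)%R%:R * q^`().[t])).
  exact: integrable_step.
have i3 e : trans e -> leb.-integrable I01 (EFin \o (fun t =>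
    shadow u e x * ((0 <= height (F e) x + t * nu e)%R%:R * q^`().[t]))).
  by move=> _; exact: (integrableZl mI _ (i2 e)).
have i4 := integrable_Rsum mI i3 (index_enum E).
have iG : leb.-integrable I01 (EFin \o G) by exact: (integrableB mI i1' i4).
transitivity (\int[leb]_(t in I01) (EFin \o G) t)%E.
  rewrite [RHS]integral_mkcond; apply: eq_integral => t _.
  rewrite /patch GE indicE; case: ifPn => tI /=; first by rewrite mul1r.
  by rewrite mul0r.
rewrite -(fineK (integrable_fin_num mI iG)); congr EFin.
transitivity (\int[leb]_(t in I01) G t) => //.
rewrite (RintegralB mI i1' i4) (RintegralZl _ mI i1) (Rintegral_sum mI i3).
rewrite Rintegral_deriv_poly//.
under eq_bigr => e he do rewrite (RintegralZl _ mI (i2 e)).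
under eq_bigr => e /andP[_ tr] do rewrite (Rintegral_step _ _ tr).
have c0 : crossing u x 0 = \1_K x + \sum_(e | trans e) shadow u e x * above e x.
  by rewrite /crossing scale0r addr0.
have c1 : crossing u x 0 = \1_K (x + u) + \sum_(e | trans e) shadow u e x * above e (x + u).
  rewrite (crossing_cst 0 1 gx).
  by rewrite /crossing scale1r.
rewrite mulrBr {1}c1 c0.
have -> : q.[1] = f (x + u) by rewrite -fq scale1r.
have -> : q.[0] = f x by rewrite -fq scale0r addr0.
have -> : \sum_(e | trans e) shadow u e x * ((0 <= height (F e) x + nu e)%R%:R * f (x + u) -
      (0 <= height (F e) x)%R%:R * f x - ((0 <= height (F e) x + nu e)%R%:R -
      (0 <= height (F e) x)%R%:R) * q.[- height (F e) x / nu e]) =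
    (\sum_(e | trans e) shadow u e x * above e (x + u)) * f (x + u) -
    (\sum_(e | trans e) shadow u e x * above e x) * f x -
    \sum_(e | trans e) shadow u e x * (above e (x + u) - above e x) * f (oblique_foot (F e) u x).
  rewrite !mulr_suml -!sumrB; apply: eq_bigr => e /andP[_ tr].
  rewrite /above -[u]scale1r height_line scale1r mul1r -/(nu e) -fq.
  have -> : x + (- height (F e) x / nu e) *: u = oblique_foot (F e) u x.
    by rewrite oblique_footE mulNr scaleNr.
  by ring.
by ring.
Qed.

(** Average over segments and use [segment_identity] on almost every line. The
    endpoint terms have the same integral over x, by translation, and each
    crossing term integrates to a flux through a face. *)
Theorem divergence f : is_polynomial f ->
  \int[lebd]_(x in K) 'D_u f x = \sum_(e | P e) nu e * face_integral (F e) f.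
Proof.
move=> pf; have bf := locally_bounded_polynomial pf.
have ig := integrable_indicM K_measurable K_bounded (locally_bounded_derive u pf).
have iKf := integrable_indicM K_measurable K_bounded bf.
have [iKfu IKfu] := Rintegral_translate u iKf.
pose cross e x : R := shadow u e x * (above e (x + u) - above e x) *
  f (oblique_foot (F e) u x).
have cr e (he : trans e) := face_integral_oblique (F_flat (proj1 (andP he))) bf (proj2 (andP he)).
have icr e : trans e -> lebd.-integrable setT (EFin \o cross e).
  by move=> he; have [] := cr e he.
have isum := integrable_Rsum measurableT icr (index_enum E).
have idiff := integrableB measurableT iKfu iKf.
pose S x : R := (\1_K (x + u) * f (x + u) - \1_K x * f x) + \sum_(e | trans e) cross e x.
have iS : lebd.-integrable setT (EFin \o S) by exact: (integrableD measurableT idiff isum).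
transitivity (\int[lebd]_x S x).
  rewrite Rintegral_indic /Rintegral (integral_average u ig); congr fine.
  apply: eq_integral_ae.
  - exact: (measurable_fubini_F (integrable_segments u ig)).
  - exact: (measurable_int _ iS).
  apply: negligibleS (generic_line_ae u) => x /=; apply: contra_not => gx.
  have [q hq] := polynomial_line pf x u.
  rewrite /S -(segment_identity gx hq); apply: eq_integral => t _.
  by have [_ ->] := is_derive_line hq t.
rewrite (RintegralD measurableT idiff isum) (RintegralB measurableT iKfu iKf) IKfu subrr add0r.
rewrite (Rintegral_sum measurableT icr).
rewrite [RHS](bigID (transversal u))/= [X in _ = _ + X]big1 ?addr0.
  by apply: eq_bigr => e he; have [_] := cr e he.
by move=> e /andP[_ /negPn/eqP]; rewrite /nu => ->; rewrite mul0r.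
Qed.

End divergence_theorem.

(** * The divergence theorem on a mesh *)

Section mesh_divergence.
Variables (R : realType) (d : nat) (Omega : set 'rV[R]_d) (T : mesh Omega).
Local Notation lebd := (lebesgue_rV R d).
Implicit Types (K : 'I_(nelt T)).

Lemma elt_open K : open (elt K).
Proof. by rewrite -elt_regular; exact: open_interior. Qed.

(** An element is its closure minus its boundary, both made of polytopes. *)
Lemma elt_measurable K : measurable (elt K).
Proof.
have -> : elt K = closure (elt K) `\` boundary (elt K).
  rewrite /boundary (interior_id (elt K)).1; last exact: elt_open.
  apply/seteqP; split => [x Kx|x [cx /not_andP[//|/contrapT]//]].
  by split; [exact: subset_closure|move=> []].
apply: measurableD; first (apply: measurable_polytope; exact: elt_polytope).
rewrite elt_boundary; apply: measurableU; apply: fin_bigcup_measurable => // e _.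
- by have [_ _ /measurable_polytope] := iface_flat e.
- by have [_ _ /measurable_polytope] := bface_flat e.
Qed.

Lemma elt_bounded K : bounded_set (elt K).
Proof.
have /bounded_polytope/bounded_onP[M hM] := elt_polytope K.
by apply/bounded_onP; exists M => x Kx; apply: hM; exact: subset_closure.
Qed.

Definition incident K (e : face T) : bool :=
  match e with
  | inl e => (fst_elt e == K) || (snd_elt e == K)
  | inr e => own_elt e == K
  end.

(** Meaningful for faces incident to K: the normal then points out of K. *)
Definition outward K (e : face T) : flat_face R d :=
  match e with
  | inl e => if fst_elt e == K then igeom e else flip (igeom e)
  | inr e => bgeom e
  end.

Lemma relint_outward K e : relint (outward K e) = relint (geom e).
Proof. by case: e => e //=; case: ifP => // _; rewrite relint_flip. Qed.

Lemma face_set_outward K e : face_set (outward K e) = face_set (geom e).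
Proof. by case: e => e //=; case: ifP. Qed.

Lemma outward_flat K e : is_flat_face (outward K e).
Proof.
by case: e => e /=; [case: ifP => _; [|apply: is_flat_face_flip]; exact: iface_flat|exact: bface_flat].
Qed.

Lemma elt_boundaryE K :
  boundary (elt K) = [set x | exists2 e, incident K e & face_set (outward K e) x].
Proof.
rewrite elt_boundary; apply/seteqP; split => x.
  move=> [] [e he ex].
    exists (inl e); last by rewrite face_set_outward.
    by case: he => <-; rewrite /= eqxx ?orbT.
  by exists (inr e); [rewrite /= he|].
move=> [[e|e]]; rewrite face_set_outward /= => he ex.
  by left; exists e => //; case/orP: he => /eqP; [left|right].
by right; exists e => //; apply/eqP.
Qed.

Lemma outward_normal K e x : incident K e -> relint (outward K e) x ->
  outward_unit_normal (elt K) x (face_normal (outward K e)).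
Proof.
rewrite relint_outward; case: e => e /= he ex; last first.
  by have [h _] := bface_normal ex; rewrite (eqP he) in h.
have [h1 h2] := iface_normal ex.
case: ifP => [/eqP <- //|/eqP nK]; case/orP: he => /eqP he; first by case: nK.
by rewrite -he.
Qed.

Lemma near0_pos (Q : R -> Prop) : (\forall t \near (0 : R), Q t) -> exists2 s, 0 < s & Q s.
Proof.
move=> /nbhs_ballP[e/= e0 h]; exists (e / 2); first by rewrite divr_gt0.
apply: h; rewrite /ball/= sub0r normrN gtr0_norm ?divr_gt0//; lra.
Qed.

(** At a common point the domain would be on one side of the boundary face, while
    the two elements that share the interior face, both parts of the domain,
    cover both sides of it. *)
Lemma relint_iface_bface (e : iface T) (b : bface T) :
  relint (igeom e) `&` relint (bgeom b) = set0.
Proof.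
apply/seteqP; split => // y [ye yb].
have [[nn1 h1] [_ h2]] := iface_normal ye.
have [_ [nnb hO]] := bface_normal yb.
set n := face_normal (igeom e) in nn1 h1 h2.
set nb := face_normal (bgeom b) in nnb hO.
(* m points out of the domain and into one of the two elements *)
pose side : R := if 0 <= dot n nb then 1 else -1.
pose m := nb + side *: n.
have nbm : 0 < dot nb m.
  rewrite /m dotDr nnb dotZr (dotC nb) /side; case: (leP 0 (dot n nb)) => ? /=; lra.
have nm : 0 < side * dot n m.
  rewrite /m dotDr dotZr nn1 /side; case: (leP 0 (dot n nb)) => ? /=; lra.
have {}h1 : \forall t \near (0 : R), elt (fst_elt e) (y + t *: m) <-> dot n (y + t *: m - y) < 0.
  apply: (@line_cvg _ _ y m 0 (fun z => elt (fst_elt e) z <-> dot n (z - y) < 0)).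
  by rewrite scale0r addr0.
have {}h2 : \forall t \near (0 : R), elt (snd_elt e) (y + t *: m) <-> dot (- n) (y + t *: m - y) < 0.
  apply: (@line_cvg _ _ y m 0 (fun z => elt (snd_elt e) z <-> dot (- n) (z - y) < 0)).
  by rewrite scale0r addr0.
have {}hO : \forall t \near (0 : R), Omega (y + t *: m) <-> dot nb (y + t *: m - y) < 0.
  apply: (@line_cvg _ _ y m 0 (fun z => Omega z <-> dot nb (z - y) < 0)).
  by rewrite scale0r addr0.
have [s s0 [[g1 g2] g3]] := near0_pos (filterI (filterI h1 h2) hO).
have dE v : dot v (y + s *: m - y) = s * dot v m.
  by rewrite addrAC subrr add0r dotZr.
have nO : ~ Omega (y + s *: m).
  by move=> /g3; rewrite dE pmulr_rlt0// ltNge ltW.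
move: nm; rewrite /side; case: ifP => _; rewrite ?mul1r ?mulN1r => nm.
- apply: nO; apply: (@elt_sub _ _ _ T (snd_elt e)); apply/g2.
  by rewrite dE dotNl pmulr_rlt0// oppr_lt0.
- apply: nO; apply: (@elt_sub _ _ _ T (fst_elt e)); apply/g1.
  by rewrite dE pmulr_rlt0// -oppr_gt0.
Qed.

Lemma relint_disjoint K e e' : incident K e -> incident K e' -> e != e' ->
  relint (outward K e) `&` relint (outward K e') = set0.
Proof.
move=> _ _; rewrite !relint_outward; case: e => e; case: e' => e' /= ee'.
- by apply: iface_disjoint; apply: contra ee' => /eqP ->.
- exact: relint_iface_bface.
- by rewrite setIC relint_iface_bface.
- by apply: bface_disjoint; apply: contra ee' => /eqP ->.
Qed.

Lemma dot_delta (n : 'rV[R]_d) (i : 'I_d) : dot n (delta_mx ord0 i) = n ord0 i.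
Proof.
rewrite /dot (bigD1 i)//= mxE !eqxx mulr1 big1 ?addr0// => j ji.
by rewrite mxE (negbTE ji) andbF mulr0.
Qed.

Lemma elt_divergence (i : 'I_d) K (f : 'rV[R]_d -> R) : is_polynomial f ->
  \int[lebd]_(x in elt K) 'D_(delta_mx ord0 i) f x =
  \sum_(e : iface T) ((fst_elt e == K)%:R - (snd_elt e == K)%:R) *
    (normal_comp i (inl e : face T) * face_integral (igeom e) f) +
  \sum_(b : bface T) (own_elt b == K)%:R *
    (normal_comp i (inr b : face T) * face_integral (bgeom b) f).
Proof.
move=> pf; have bf := locally_bounded_polynomial pf.
rewrite (divergence (@elt_open K) (elt_measurable K) (@elt_bounded K) (elt_boundaryE K)
  (fun e _ => outward_flat K e) (@outward_normal K) (@relint_disjoint K) _ pf).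
rewrite big_sumType /=; congr (_ + _).
- rewrite big_mkcond; apply: eq_bigr => e _ /=; rewrite dot_delta.
  have [fK|fK] /= := eqVneq (fst_elt e) K.
    have -> : (snd_elt e == K) = false.
      by apply/negbTE; rewrite -fK neq_ltn fst_snd_lt orbT.
    by rewrite subr0 mul1r.
  case: ifP => _; last by rewrite subrr mul0r.
  by rewrite (face_integral_flip (iface_flat e) bf) /= mxE sub0r mulN1r mulNr.
- rewrite big_mkcond; apply: eq_bigr => e _ /=; rewrite dot_delta.
  by case: ifP => _; rewrite ?mul1r ?mul0r.
Qed.

(** Interior faces receive contributions from both sides, with opposite normals. *)
Lemma mesh_divergence (i : 'I_d) (f : pwfun T) : (forall K, is_polynomial (f K)) ->
  \sum_K \int[lebd]_(x in elt K) pderiv i f K x =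
  \sum_(e : iface T) normal_comp i (inl e : face T) *
     (face_integral (igeom e) (f (fst_elt e)) - face_integral (igeom e) (f (snd_elt e))) +
  \sum_(b : bface T) normal_comp i (inr b : face T) * face_integral (bgeom b) (f (own_elt b)).
Proof.
move=> pf; rewrite /pderiv.
under eq_bigr => K _ do rewrite (elt_divergence i K (pf K)).
rewrite big_split /= exchange_big [X in _ + X]exchange_big /=; congr (_ + _).
- apply: eq_bigr => e _.
  under eq_bigr do rewrite mulrBl; rewrite sumrB mulrBr; congr (_ - _).
  + rewrite (bigD1 (fst_elt e))//= eqxx mul1r big1 ?addr0// => K.
    by rewrite eq_sym => /negbTE ->; rewrite mul0r.
  + rewrite (bigD1 (snd_elt e))//= eqxx mul1r big1 ?addr0// => K.
    by rewrite eq_sym => /negbTE ->; rewrite mul0r.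
- apply: eq_bigr => b _; rewrite (bigD1 (own_elt b))//= eqxx mul1r big1 ?addr0// => K.
  by rewrite eq_sym => /negbTE ->; rewrite mul0r.
Qed.

End mesh_divergence.

(** * Linear forms on piecewise polynomials *)

Section galerkin.
Variables (R : realType) (d : nat) (Omega : set 'rV[R]_d) (T : mesh Omega).
Local Notation lebd := (lebesgue_rV R d).
Implicit Types (K : 'I_(nelt T)) (v w phi psi : pwfun T).

Lemma face_integralD e (f g : 'rV[R]_d -> R) : is_flat_face e ->
  locally_bounded f -> locally_bounded g ->
  face_integral e (fun x => f x + g x) = face_integral e f + face_integral e g.
Proof.
move=> fe bf bg; have [_ _ pe _ _] := fe; rewrite !face_integralE//.
rewrite -(RintegralD measurableT (prism_integrable _ 0 1 pe (locally_bounded_foot e _ bf))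
  (prism_integrable _ 0 1 pe (locally_bounded_foot e _ bg))).
by apply: eq_Rintegral => x _; rewrite mulrDr.
Qed.

Lemma face_integralZ e (a : R) (f : 'rV[R]_d -> R) : is_flat_face e ->
  locally_bounded f ->
  face_integral e (fun x => a * f x) = a * face_integral e f.
Proof.
move=> fe bf; have [_ _ pe _ _] := fe; rewrite !face_integralE//.
rewrite -(RintegralZl _ measurableT (prism_integrable _ 0 1 pe (locally_bounded_foot e _ bf))).
by apply: eq_Rintegral => x _; rewrite mulrCA.
Qed.

Lemma face_integral_linear e (a : R) (f g : 'rV[R]_d -> R) : is_flat_face e ->
  locally_bounded f -> locally_bounded g ->
  face_integral e (fun x => a * f x + g x) = a * face_integral e f + face_integral e g.
Proof.
move=> fe bf bg; rewrite face_integralD//; first by rewrite face_integralZ.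
by apply: locally_boundedM => //; exact: locally_bounded_cst.
Qed.

Lemma eq_face_integral (e : flat_face R d) (f g : 'rV[R]_d -> R) : f =1 g ->
  face_integral e f = face_integral e g.
Proof. by move=> /funext ->. Qed.

Lemma elt_integral_linear K (a : R) (f g : 'rV[R]_d -> R) :
  locally_bounded f -> locally_bounded g ->
  \int[lebd]_(x in elt K) (a * f x + g x) =
  a * \int[lebd]_(x in elt K) f x + \int[lebd]_(x in elt K) g x.
Proof.
move=> bf bg; rewrite !(Rintegral_indic (elt K)).
have i1 := integrable_indicM (elt_measurable K) (@elt_bounded _ _ _ _ K) bf.
have i2 := integrable_indicM (elt_measurable K) (@elt_bounded _ _ _ _ K) bg.
rewrite -(RintegralZl a measurableT i1) -(RintegralD measurableT (integrableZl measurableT a i1) i2).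
by apply: eq_Rintegral => x _; rewrite mulrDr mulrCA.
Qed.

Definition locally_bounded_pw v := forall K, locally_bounded (v K).

Lemma Vh_polynomial r v K : Vh r v -> is_polynomial (v K).
Proof. by move=> /(_ K)/polynomial_fun_is_polynomial. Qed.

Lemma Vh_locally_bounded r v : Vh r v -> locally_bounded_pw v.
Proof. by move=> hv K; apply: locally_bounded_polynomial; exact: Vh_polynomial hv. Qed.

Lemma pderiv_locally_bounded r i v : Vh r v -> locally_bounded_pw (pderiv i v).
Proof. by move=> hv K; apply: locally_bounded_derive; exact: Vh_polynomial hv. Qed.

Lemma Vh_linear r (a : R) v w : Vh r v -> Vh r w -> Vh r (fun K x => a * v K x + w K x).
Proof.
move=> hv hw K; have [p [sp ->]] := hv K; have [q [sq ->]] := hw K.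
exists (a *: p + q); split; last first.
  by apply/funext => x; rewrite mpoly.mevalD mpoly.mevalZ.
apply: leq_trans (mpoly.msizeD_le _ _) _; rewrite geq_max sq andbT.
exact: leq_trans (mpoly.msizeZ_le _ _) sp.
Qed.

Lemma Vh0 r : Vh r ((fun _ _ => 0) : pwfun T).
Proof.
move=> K; exists 0; split; first by rewrite mpoly.msize0.
by apply/funext => x; rewrite mpoly.meval0.
Qed.

Definition linear_on r (L : pwfun T -> R) := forall a v w, Vh r v -> Vh r w ->
  L (fun K x => a * v K x + w K x) = a * L v + L w.

Lemma linear_on0 r (L : pwfun T -> R) : linear_on r L -> L (fun _ _ => 0) = 0.
Proof.
move=> linL; have := linL 1 _ _ (Vh0 r) (Vh0 r).
rewrite (_ : (fun K x => _) = fun _ _ => 0); last first.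
  by apply/funext => K; apply/funext => x; rewrite mulr0 addr0.
by rewrite mul1r => /eqP; rewrite -[X in X == _]addr0 (inj_eq (addrI _)) eq_sym => /eqP.
Qed.

Lemma linear_on_sum r (L : pwfun T -> R) (I : Type) (s : seq I) (c : I -> R)
    (b : I -> pwfun T) : linear_on r L -> (forall i, Vh r (b i)) ->
  Vh r (fun K x => \sum_(i <- s) c i * b i K x) /\
  L (fun K x => \sum_(i <- s) c i * b i K x) = \sum_(i <- s) c i * L (b i).
Proof.
move=> linL hb; elim: s => [|i s [IH1 IH2]].
  rewrite (_ : (fun K x => _) = fun _ _ => 0); last first.
    by apply/funext => K; apply/funext => x; rewrite big_nil.
  split; first exact: Vh0.
  by rewrite big_nil (linear_on0 linL).
rewrite (_ : (fun K x => _) = fun K x => c i * b i K x + \sum_(i <- s) c i * b i K x); last first.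
  by apply/funext => K; apply/funext => x; rewrite big_cons.
split; first exact: Vh_linear.
by rewrite linL// IH2 big_cons.
Qed.

Lemma inner_eltsC v w : inner_elts v w = inner_elts w v.
Proof. by apply: eq_bigr => K _; apply: eq_Rintegral => x _; rewrite mulrC. Qed.

Lemma inner_elts_linear (a : R) v w phi :
  locally_bounded_pw v -> locally_bounded_pw w -> locally_bounded_pw phi ->
  inner_elts phi (fun K x => a * v K x + w K x) = a * inner_elts phi v + inner_elts phi w.
Proof.
move=> bv bw bp; rewrite /inner_elts mulr_sumr -big_split; apply: eq_bigr => K _ /=.
rewrite -elt_integral_linear; [|exact: locally_boundedM..].
by apply: eq_Rintegral => x _; rewrite mulrDr mulrCA.
Qed.

Lemma inner_elts_definite r v : Vh r v -> inner_elts v v = 0 -> v = fun _ _ => 0.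
Proof.
move=> hv /eqP; rewrite psumr_eq0 => [/allP h|K _]; last first.
  by apply: Rintegral_ge0 => x _; rewrite -expr2 sqr_ge0.
apply/funext => K; have := h K; rewrite mem_index_enum => /(_ isT)/eqP h0.
apply: (@polynomial_sqr_eq0 _ _ (v K) (elt K)) => //.
- exact: Vh_polynomial hv.
- exact: elt_open.
- exact: elt_neq0.
- exact: elt_measurable.
- exact: elt_bounded.
Qed.

(** The hypothesis holds in particular for the columns of the cokernel matrix of G,
    which detects membership in the row space. *)
Lemma dual_solvable (F : fieldType) (n : nat) (G : 'M[F]_n) (l : 'rV[F]_n) :
  (forall c : 'cV_n, G *m c = 0 -> l *m c = 0) -> exists w : 'rV_n, w *m G = l.
Proof.
move=> h; have : (l <= G)%MS.
  rewrite submxE; apply/eqP/matrixP => i j.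
  have Gj : G *m col j (cokermx G) = 0.
    by rewrite colE mulmxA mulmx_coker mul0mx.
  have /matrixP/(_ i ord0) := h _ Gj; rewrite !mxE => h0.
  by rewrite -[RHS]h0; apply: eq_bigr => k _; rewrite !mxE.
by move=> /submxP[w ->]; exists w.
Qed.

Lemma linear_on_inner_elts r phi : locally_bounded_pw phi ->
  linear_on r (inner_elts phi).
Proof.
by move=> bp a v w hv hw; apply: inner_elts_linear => //; exact: Vh_locally_bounded.
Qed.

(** The monomials of degree at most r, one family for each element. *)
Lemma Vh_spanned r : exists (n : nat) (b : 'I_n -> pwfun T),
  (forall i, Vh r (b i)) /\
  forall v, Vh r v -> exists c : 'I_n -> R, v = fun K x => \sum_i c i * b i K x.
Proof.
pose J := ('I_(nelt T) * mpoly.bmultinom d r.+1)%type.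
pose b (j : J) : pwfun T := fun K x =>
  (K == j.1)%:R * mpoly.meval (x ord0) (mpoly.mpolyX R (mpoly.bmnm j.2)).
exists #|{: J}|, (fun i => b (enum_val i)); split.
  move=> i K; exists ((K == (enum_val i).1)%:R *: mpoly.mpolyX R (mpoly.bmnm (enum_val i).2)).
  split; last by apply/funext => x; rewrite mpoly.mevalZ.
  apply: leq_trans (mpoly.msizeZ_le _ _) _; rewrite mpoly.msizeX.
  exact: mpoly.bmdeg.
move=> v hv; pose p K := projT1 (cid (hv K)).
have [sp vp] : (forall K, mpoly.msize (p K) <= r.+1)%N /\
    forall K, v K = fun x => mpoly.meval (x ord0) (p K).
  by split => K; rewrite /p; case: cid => ? [].
exists (fun i => mpoly.mcoeff (mpoly.bmnm (enum_val i).2) (p (enum_val i).1)).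
apply/funext => K; apply/funext => x.
rewrite -(big_enum_val (A := {: J}) (fun j : J => mpoly.mcoeff (mpoly.bmnm j.2) (p j.1) * b j K x)) /=.
rewrite (eq_bigl xpredT)//.
rewrite (eq_bigr (fun j : J => mpoly.mcoeff (mpoly.bmnm j.2) (p j.1) * b (j.1, j.2) K x)); last by case.
rewrite -(pair_bigA _ (fun K' m => mpoly.mcoeff (mpoly.bmnm m) (p K') * b (K', m) K x)) /=.
rewrite (bigD1 K)//= [X in _ = _ + X]big1 ?addr0; last first.
  by move=> K' KK'; rewrite big1// => m _; rewrite /b /= eq_sym (negbTE KK') mul0r mulr0.
rewrite vp {1}(mpoly.mpolywE (sp K)) raddf_sum; apply: eq_bigr => m _ /=.
by rewrite mpoly.mevalZ /b /= eqxx mul1r.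
Qed.

(** Solve the linear system given by the Gram matrix of a spanning family. It is
    solvable because a combination with coefficients in the kernel of the Gram
    matrix has norm zero, hence is the zero function, where L vanishes. *)
Lemma riesz r (L : pwfun T -> R) : linear_on r L ->
  exists2 w, Vh r w & forall phi, Vh r phi -> inner_elts w phi = L phi.
Proof.
move=> linL; have [n [b [hb span]]] := Vh_spanned r.
pose G := \matrix_(i < n, j < n) inner_elts (b i) (b j).
have comb (c : 'I_n -> R) (M : pwfun T -> R) : linear_on r M ->
    M (fun K x => \sum_i c i * b i K x) = \sum_i c i * M (b i).
  by move=> linM; have [_] := linear_on_sum (index_enum _) c linM hb.
have hcomb (c : 'I_n -> R) : Vh r (fun K x => \sum_i c i * b i K x).
  by have [] := linear_on_sum (index_enum _) c linL hb.
have linb v : Vh r v -> linear_on r (inner_elts v).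
  by move=> hv; apply: linear_on_inner_elts; exact: Vh_locally_bounded hv.
have [W WG] : exists W : 'rV_n, W *m G = \row_j L (b j).
  apply: dual_solvable => c Gc0.
  pose phi : pwfun T := fun K x => \sum_i c i ord0 * b i K x.
  have bphi i : inner_elts (b i) phi = 0.
    rewrite (comb _ _ (linb _ (hb i))); move/matrixP/(_ i ord0): Gc0; rewrite !mxE => G0.
    by rewrite -[RHS]G0; apply: eq_bigr => j _; rewrite mxE mulrC.
  have phi0 : phi = fun _ _ => 0.
    apply: (inner_elts_definite (hcomb _)); rewrite (comb _ _ (linb _ (hcomb _))).
    by rewrite big1// => i _; rewrite inner_eltsC bphi mulr0.
  have := comb (fun i => c i ord0) L linL; rewrite -/phi phi0 (linear_on0 linL) => Lc0.
  apply/matrixP => i j; rewrite !ord1 !mxE [RHS]Lc0.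
  by apply: eq_bigr => k _; rewrite mxE mulrC.
exists (fun K x => \sum_i W ord0 i * b i K x) => // phi /span[c ->].
rewrite (comb _ _ (linb _ (hcomb _))) (comb _ _ linL); apply: eq_bigr => j _; congr (_ * _).
rewrite inner_eltsC (comb _ _ (linb _ (hb j))).
move/matrixP/(_ ord0 j): WG; rewrite !mxE => <-.
by apply: eq_bigr => i _; rewrite mxE inner_eltsC.
Qed.

End galerkin.

(** * Integration by parts *)

Section integration_by_parts.
Variables (R : realType) (d : nat) (Omega : set 'rV[R]_d) (T : mesh Omega).
Variables (gamma : bool -> 'I_d -> iface T -> R) (r : nat).
Local Notation lebd := (lebesgue_rV R d).
Implicit Types (v w phi psi : pwfun T).

Lemma locally_bounded_jump v e : locally_bounded_pw v -> locally_bounded (jump v e).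
Proof. by case: e => e bv /=; [apply: locally_boundedB|]; exact: bv. Qed.

Lemma locally_bounded_Qtrace s i v e : locally_bounded_pw v ->
  locally_bounded (Qtrace s i v e).
Proof. by case: e => e bv; rewrite /Qtrace; [case: s; case: (_ < 0)|]; exact: bv. Qed.

Lemma locally_bounded_penalty s i v e : locally_bounded_pw v ->
  locally_bounded (penalty gamma s i v e).
Proof.
case: e => e bv; rewrite /penalty; last exact: locally_bounded_cst.
by apply: locally_boundedM; [exact: locally_bounded_cst|exact: locally_bounded_jump].
Qed.

Lemma linear_inner_ifaces (g : facefun T) : (forall e, locally_bounded (g e)) ->
  linear_on r (fun phi => inner_ifaces g (jump phi)).
Proof.
move=> bg a v w /Vh_locally_bounded bv /Vh_locally_bounded bw.
rewrite /inner_ifaces mulr_sumr -big_split; apply: eq_bigr => e _ /=.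
rewrite -face_integral_linear; first last.
- by apply: locally_boundedM => //; exact: (locally_bounded_jump (inl e) bw).
- by apply: locally_boundedM => //; exact: (locally_bounded_jump (inl e) bv).
- exact: iface_flat.
by apply: eq_face_integral => x; ring.
Qed.

Lemma linear_inner_bfaces (g : facefun T) : (forall e, locally_bounded (g e)) ->
  linear_on r (fun phi => inner_bfaces g (jump phi)).
Proof.
move=> bg a v w /Vh_locally_bounded bv /Vh_locally_bounded bw.
rewrite /inner_bfaces mulr_sumr -big_split; apply: eq_bigr => e _ /=.
rewrite -face_integral_linear; first last.
- by apply: locally_boundedM => //; exact: (locally_bounded_jump (inr e) bw).
- by apply: locally_boundedM => //; exact: (locally_bounded_jump (inr e) bv).
- exact: bface_flat.
by apply: eq_face_integral => x; ring.
Qed.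

Lemma linear_inner_pderiv i v : locally_bounded_pw v ->
  linear_on r (fun phi => inner_elts v (pderiv i phi)).
Proof.
move=> bv a phi psi hphi hpsi.
rewrite -(inner_elts_linear a (pderiv_locally_bounded i hphi) (pderiv_locally_bounded i hpsi) bv).
congr inner_elts; apply/funext => K; apply/funext => x; rewrite /pderiv.
have pphi := Vh_polynomial K hphi; have ppsi := Vh_polynomial K hpsi.
rewrite (deriveD (f := fun x => a * phi K x)); last 2 first.
- apply: (derivableZ (f := phi K)); exact: derivable_polynomial.
- exact: derivable_polynomial.
congr (_ + _); rewrite (deriveZ (f := phi K))//; exact: derivable_polynomial.
Qed.

(** The linear form that a discrete derivative of v represents. *)
Definition derivative_form s i v phi : R :=
  inner_faces (fun e x => Qtrace s i v e x * normal_comp i e) (jump phi)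
    - inner_elts v (pderiv i phi) + inner_ifaces (penalty gamma s i v) (jump phi).

Lemma linear_derivative_form s i v : locally_bounded_pw v ->
  linear_on r (derivative_form s i v).
Proof.
move=> bv a phi psi hphi hpsi.
have bQ e : locally_bounded (fun x => Qtrace s i v e x * normal_comp i e).
  by apply: locally_boundedM; [exact: locally_bounded_Qtrace|exact: locally_bounded_cst].
have bp e : locally_bounded (penalty gamma s i v e) by exact: locally_bounded_penalty.
rewrite /derivative_form /inner_faces.
rewrite (linear_inner_ifaces bQ a hphi hpsi) (linear_inner_bfaces bQ a hphi hpsi).
rewrite (linear_inner_pderiv i bv a hphi hpsi) (linear_inner_ifaces bp a hphi hpsi).
have lin (i1 i2 b1 b2 d1 d2 p1 p2 : R) :
    a * i1 + i2 + (a * b1 + b2) - (a * d1 + d2) + (a * p1 + p2) =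
    a * (i1 + b1 - d1 + p1) + (i2 + b2 - d2 + p2) by ring.
exact: lin.
Qed.

Lemma discrete_derivP s i v : locally_bounded_pw v ->
  is_discrete_deriv gamma r s i v (discrete_deriv gamma r s i v).
Proof.
move=> bv; apply: getPex.
by have [w hw wE] := riesz (linear_derivative_form s i bv); exists w.
Qed.

Hypothesis gammaN : forall i e, gamma true i e = - gamma false i e.

Lemma gamma_negb s i e : gamma (~~ s) i e = - gamma s i e.
Proof. by case: s; rewrite /= gammaN ?opprK. Qed.

(** Add the defining identities of the two derivatives, each tested with the other
    function. The volume terms form the integral of the derivative of v phi and
    are moved to the faces by [mesh_divergence]. On an interior face the
    cancellation is pointwise: v1 phi1 - v2 phi2 = Q^s(v) [phi] + Q^-s(phi) [v]
    for the values on the two sides. On a boundary face v phi n occurs twice on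
    one side and once on the other. *)
Lemma discrete_deriv_by_parts s i v phi : Vh r v -> Vh r phi ->
  inner_elts (discrete_deriv gamma r s i v) phi =
  - inner_elts v (discrete_deriv gamma r (~~ s) i phi) +
  inner_bfaces (fun e x => btrace v e x * normal_comp i e) (btrace phi).
Proof.
move=> hv hphi.
have bv := Vh_locally_bounded hv; have bphi := Vh_locally_bounded hphi.
have [_ /(_ _ hphi) ->] := discrete_derivP s i bv.
have [_ /(_ _ hv)] := discrete_derivP (~~ s) i bphi.
rewrite [in X in _ -> _ = - X + _]inner_eltsC => ->.
have vol : inner_elts v (pderiv i phi) + inner_elts phi (pderiv i v) =
    \sum_K \int[lebd]_(x in elt K) pderiv i (fun K y => v K y * phi K y) K x.
  rewrite /inner_elts -big_split; apply: eq_bigr => K _ /=.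
  have := @elt_integral_linear _ _ _ T K 1 _ _
    (locally_boundedM (bv K) (pderiv_locally_bounded i hphi K))
    (locally_boundedM (bphi K) (pderiv_locally_bounded i hv K)).
  rewrite mul1r => <-; apply: eq_Rintegral => x _.
  by rewrite /pderiv deriveM_polynomial ?mul1r//; [exact: Vh_polynomial hv|exact: Vh_polynomial hphi].
rewrite mesh_divergence in vol; last first.
  by move=> K; apply: is_polynomialM; [exact: Vh_polynomial hv|exact: Vh_polynomial hphi].
have bQ s' (w : pwfun T) e : locally_bounded_pw w ->
    locally_bounded (fun x => Qtrace s' i w e x * normal_comp i e).
  by move=> bw; apply: locally_boundedM; [exact: locally_bounded_Qtrace|exact: locally_bounded_cst].
have inner_part :
    inner_ifaces (fun e x => Qtrace s i v e x * normal_comp i e) (jump phi) +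
    inner_ifaces (fun e x => Qtrace (~~ s) i phi e x * normal_comp i e) (jump v) +
    (inner_ifaces (penalty gamma s i v) (jump phi) +
    inner_ifaces (penalty gamma (~~ s) i phi) (jump v)) =
    \sum_(e : iface T) normal_comp i (inl e : face T) *
     (face_integral (igeom e) (fun y => v (fst_elt e) y * phi (fst_elt e) y) -
      face_integral (igeom e) (fun y => v (snd_elt e) y * phi (snd_elt e) y)).
  rewrite /inner_ifaces -!big_split; apply: eq_bigr => e _ /=.
  have fe := iface_flat e.
  have bj w : locally_bounded_pw w -> locally_bounded (jump w (inl e)).
    exact: locally_bounded_jump.
  have bg s' w w' : locally_bounded_pw w -> locally_bounded_pw w' ->
      locally_bounded (fun x =>
        Qtrace s' i w (inl e) x * normal_comp i (inl e : face T) * jump w' (inl e) x).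
    by move=> bw bw'; apply: locally_boundedM; [exact: bQ|exact: bj].
  have bp s' w w' : locally_bounded_pw w -> locally_bounded_pw w' ->
      locally_bounded (fun x => penalty gamma s' i w (inl e) x * jump w' (inl e) x).
    by move=> bw bw'; apply: locally_boundedM; [exact: locally_bounded_penalty|exact: bj].
  have bvp K : locally_bounded (fun y => v K y * phi K y) by exact: locally_boundedM.
  rewrite -(face_integralD fe (bg s v phi bv bphi) (bg (~~ s) phi v bphi bv)).
  rewrite -(face_integralD fe (bp s v phi bv bphi) (bp (~~ s) phi v bphi bv)).
  rewrite -(face_integralD fe (locally_boundedD (bg s v phi bv bphi) (bg (~~ s) phi v bphi bv))
    (locally_boundedD (bp s v phi bv bphi) (bp (~~ s) phi v bphi bv))).
  transitivity (face_integral (igeom e) (fun y => normal_comp i (inl e : face T) *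
      (-1 * (v (snd_elt e) y * phi (snd_elt e) y) + v (fst_elt e) y * phi (fst_elt e) y))).
    apply: eq_face_integral => x; rewrite /penalty /Qtrace /jump gamma_negb.
    by case: (s) => /=; case: (_ < 0); ring.
  rewrite face_integralZ//; last first.
    by apply: locally_boundedD => //; apply: locally_boundedM => //; exact: locally_bounded_cst.
  by rewrite face_integral_linear// mulN1r addrC.
have boundary_part :
    inner_bfaces (fun e x => Qtrace s i v e x * normal_comp i e) (jump phi) +
    inner_bfaces (fun e x => Qtrace (~~ s) i phi e x * normal_comp i e) (jump v) =
    \sum_(b : bface T) normal_comp i (inr b : face T) *
      face_integral (bgeom b) (fun y => v (own_elt b) y * phi (own_elt b) y) +
    inner_bfaces (fun e x => btrace v e x * normal_comp i e) (btrace phi).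
  rewrite /inner_bfaces -!big_split; apply: eq_bigr => b _ /=.
  rewrite -face_integralZ; first last.
  - exact: locally_boundedM.
  - exact: bface_flat.
  by congr (_ + _); apply: eq_face_integral => x; ring.
have lin (i1 b1 p1 i2 b2 p2 a1 a2 s1 s2 t : R) : i1 + i2 + (p1 + p2) = s1 ->
    b1 + b2 = s2 + t -> a1 + a2 = s1 + s2 ->
    i1 + b1 - a1 + p1 = - (i2 + b2 - a2 + p2) + t.
  move=> E1 E2 E3.
  have -> : t = b1 + b2 - (a1 + a2 - (i1 + i2 + (p1 + p2))) by rewrite E1 E2 E3; ring.
  by ring.
exact: lin inner_part boundary_part vol.
Qed.

Lemma discrete_deriv_locally_bounded s i v : locally_bounded_pw v ->
  locally_bounded_pw (discrete_deriv gamma r s i v).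
Proof. by move=> bv; have [/Vh_locally_bounded] := discrete_derivP s i bv. Qed.

Lemma inner_elts_suml (w : 'I_d -> pwfun T) phi :
  (forall i, locally_bounded_pw (w i)) -> locally_bounded_pw phi ->
  inner_elts (fun K x => \sum_i w i K x) phi = \sum_i inner_elts (w i) phi.
Proof.
move=> bw bp; rewrite /inner_elts exchange_big; apply: eq_bigr => K _ /=.
rewrite Rintegral_indic; under [RHS]eq_bigr do rewrite Rintegral_indic.
rewrite -(Rintegral_sum measurableT (P := xpredT)
  (F := fun i x => \1_(elt K) x * (w i K x * phi K x))); last first.
  move=> i _; apply: integrable_indicM; [exact: elt_measurable|exact: elt_bounded|].
  by apply: locally_boundedM; [exact: bw|exact: bp].
by apply: eq_Rintegral => x _; rewrite mulr_suml mulr_sumr.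
Qed.

Lemma inner_elts_vecE (v w : 'I_d -> pwfun T) :
  (forall i, locally_bounded_pw (v i)) -> (forall i, locally_bounded_pw (w i)) ->
  inner_elts_vec v w = \sum_i inner_elts (v i) (w i).
Proof.
move=> bv bw; rewrite /inner_elts_vec /inner_elts exchange_big; apply: eq_bigr => K _ /=.
rewrite Rintegral_indic; under [RHS]eq_bigr do rewrite Rintegral_indic.
rewrite -(Rintegral_sum measurableT (P := xpredT)
  (F := fun i x => \1_(elt K) x * (v i K x * w i K x))); last first.
  move=> i _; apply: integrable_indicM; [exact: elt_measurable|exact: elt_bounded|].
  by apply: locally_boundedM; [exact: bv|exact: bw].
by apply: eq_Rintegral => x _; rewrite mulr_sumr.
Qed.

Lemma inner_bfaces_normal_trace (v : 'I_d -> pwfun T) phi :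
  (forall i, locally_bounded_pw (v i)) -> locally_bounded_pw phi ->
  inner_bfaces (normal_trace v) (btrace phi) =
  \sum_i inner_bfaces (fun e x => btrace (v i) e x * normal_comp i e) (btrace phi).
Proof.
move=> bv bp; rewrite /inner_bfaces exchange_big; apply: eq_bigr => b _ /=.
have fb := bface_flat b; have [_ _ pb _ _] := fb.
rewrite face_integralE//; under [RHS]eq_bigr do rewrite face_integralE//.
pose g i x := v i (own_elt b) x * normal_comp i (inr b : face T) * phi (own_elt b) x.
rewrite -(Rintegral_sum measurableT (P := xpredT) (F := fun i x =>
  \1_(prism (bgeom b) (face_normal (bgeom b)) 0 1) x *
  g i (oblique_foot (bgeom b) (face_normal (bgeom b)) x))); last first.
  move=> i _; apply: prism_integrable => //.
  apply: (locally_bounded_foot _ _ (f := g i)).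
  apply: locally_boundedM; last exact: bp.
  by apply: locally_boundedM; [exact: bv|exact: locally_bounded_cst].
by apply: eq_Rintegral => x _; rewrite /normal_trace mulr_suml mulr_sumr.
Qed.

Lemma div_sign_by_parts s (v : 'I_d -> pwfun T) phi :
  (forall i, Vh r (v i)) -> Vh r phi ->
  inner_elts (div_sign gamma r s v) phi =
    - inner_elts_vec v (grad_sign gamma r (~~ s) phi)
    + inner_bfaces (normal_trace v) (btrace phi).
Proof.
move=> hv hphi; have bv i := Vh_locally_bounded (hv i); have bp := Vh_locally_bounded hphi.
rewrite /div_sign /grad_sign inner_elts_suml//; last first.
  by move=> i; exact: discrete_deriv_locally_bounded.
rewrite inner_elts_vecE//; last by move=> i; exact: discrete_deriv_locally_bounded.
rewrite inner_bfaces_normal_trace// -sumrN -big_split; apply: eq_bigr => i _ /=.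
exact: discrete_deriv_by_parts.
Qed.

Lemma inner_elts_mean v w phi : locally_bounded_pw v -> locally_bounded_pw w ->
  locally_bounded_pw phi ->
  inner_elts phi (fun K x => 2^-1 * (v K x + w K x)) =
  2^-1 * (inner_elts phi v + inner_elts phi w).
Proof.
move=> bv bw bp.
have bw' : locally_bounded_pw (fun K x => 2^-1 * w K x).
  by move=> K; apply: locally_boundedM => //; exact: locally_bounded_cst.
have b0 : locally_bounded_pw ((fun _ _ => 0) : pwfun T).
  by move=> K; exact: locally_bounded_cst.
have z : inner_elts phi (fun _ _ => 0) = 0.
  exact: (linear_on0 (linear_on_inner_elts (r := 0%N) bp)).
have wE : inner_elts phi (fun K x => 2^-1 * w K x) = 2^-1 * inner_elts phi w.
  rewrite -[RHS]addr0 -[X in _ + X]z -inner_elts_linear//; congr inner_elts.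
  by apply/funext => K; apply/funext => x; rewrite addr0.
rewrite mulrDr -wE -inner_elts_linear//; congr inner_elts.
by apply/funext => K; apply/funext => x; rewrite mulrDr.
Qed.

Lemma locally_bounded_div_sign s (v : 'I_d -> pwfun T) :
  (forall i, Vh r (v i)) -> locally_bounded_pw (div_sign gamma r s v).
Proof.
move=> hv K; apply: locally_bounded_sum => i _.
by apply: discrete_deriv_locally_bounded; exact: Vh_locally_bounded (hv i).
Qed.

Lemma div_by_parts (v : 'I_d -> pwfun T) phi :
  (forall i, Vh r (v i)) -> Vh r phi ->
  inner_elts (div gamma r v) phi =
    - inner_elts_vec v (grad gamma r phi)
    + inner_bfaces (normal_trace v) (btrace phi).
Proof.
move=> hv hphi; have bv i := Vh_locally_bounded (hv i); have bp := Vh_locally_bounded hphi.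
have bgrad s i : locally_bounded_pw (grad_sign gamma r s phi i).
  exact: discrete_deriv_locally_bounded.
have divE : inner_elts (div gamma r v) phi =
    2^-1 * (inner_elts (div_sign gamma r false v) phi + inner_elts (div_sign gamma r true v) phi).
  rewrite inner_eltsC inner_elts_mean//; try exact: locally_bounded_div_sign.
  by rewrite ![inner_elts phi _]inner_eltsC.
have gradE : inner_elts_vec v (grad gamma r phi) =
    2^-1 * (inner_elts_vec v (grad_sign gamma r false phi) +
      inner_elts_vec v (grad_sign gamma r true phi)).
  rewrite !inner_elts_vecE//; last first.
    move=> i K; apply: locally_boundedM; first exact: locally_bounded_cst.
    by apply: locally_boundedD; exact: bgrad.
  rewrite -big_split mulr_sumr; apply: eq_bigr => i _ /=.
  by rewrite inner_elts_mean.
have lin (a0 a1 b : R) :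
    2^-1 * (- a1 + b + (- a0 + b)) = - (2^-1 * (a0 + a1)) + b by field.
by rewrite divE gradE !div_sign_by_parts//=; exact: lin.
Qed.

End integration_by_parts.

Theorem theorem4p5 (R : realType) (d : nat) (d_gt0 : (0 < d)%N)
    (Omega : set 'rV[R]_d) (Omega_open : open Omega)
    (Omega_neq0 : Omega !=set0) (Omega_connected : connected Omega)
    (Omega_bounded : bounded_set Omega)
    (T : mesh Omega)
    (sigma : R) (sigma_gt0 : 0 < sigma) (T_regular : shape_regular T sigma)
    (tau : R) (tau_gt0 : 0 < tau) (T_uniform : locally_quasi_uniform T tau)
    (gamma : bool -> 'I_d -> iface T -> R) (r : nat)
    (gammaN : forall i e, gamma true i e = - gamma false i e) :
  forall (v : 'I_d -> pwfun T) (phi : pwfun T),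
    (forall i, Vh r (v i)) -> Vh r phi ->
    (forall s : bool,
      inner_elts (div_sign gamma r s v) phi =
        - inner_elts_vec v (grad_sign gamma r (~~ s) phi)
        + inner_bfaces (normal_trace v) (btrace phi)) /\
    inner_elts (div gamma r v) phi =
      - inner_elts_vec v (grad gamma r phi)
      + inner_bfaces (normal_trace v) (btrace phi).
Proof.
move=> v phi hv hphi; split; last exact: div_by_parts.
by move=> s; exact: div_sign_by_parts.
Qed.
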